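(* Let $G$ be a finite group, $k$ an algebraically closed field of characteristic zero, and $\omega$ a normalized $3$-cocycle on $G$ with values in $k^\times$. Let $K,H$ be normal subgroups of $G$ centralizing each other and $B:K\times H\to k^\times$ a $G$-invariant $\omega$-bicharacter. The Gauss sum of the fusion subcategory $\mathcal{S}(K,H,B)$ of $\operatorname{Rep}(D^\omega(G))$ is $$\tau(\mathcal{S}(K,H,B))=\frac{|G|}{|H|}\sum_{a\in K\cap H\cap R}|K_a|\,B(a,a).$$ When $\mathcal{S}(K,H,B)$ is nondegenerate its Gauss sum is $$\tau(\mathcal{S}(K,H,B))=\frac{|K|}{|K\cap H|}\sum_{a\in K\cap H}B(a,a)$$ and its central charge is $$\zeta(\mathcal{S}(K,H,B))=\frac{1}{\sqrt{|K\cap H|}}\sum_{a\in K\cap H}B(a,a).$$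
   Context: A normalized 3-cocycle is a map $\omega:G^3\to k^\times$ with $\omega(g_2,g_3,g_4)\,\omega(g_1,g_2g_3,g_4)\,\omega(g_1,g_2,g_3)=\omega(g_1g_2,g_3,g_4)\,\omega(g_1,g_2,g_3g_4)$ and $\omega(g,e,l)=1$ ($e$ the identity of $G$). For $a,x,y\in G$ put $\beta_a(x,y)=\frac{\omega(a,x,y)\,\omega(x,y,y^{-1}x^{-1}axy)}{\omega(x,x^{-1}ax,y)}$ and $\gamma_a(x,y)=\frac{\omega(x,y,a)\,\omega(a,a^{-1}xa,a^{-1}ya)}{\omega(x,a,a^{-1}ya)}$. $D^\omega(G)$ is the Dijkgraaf--Pasquier--Roche quasi-triangular quasi-Hopf algebra with basis $\{\delta_g\overline{x}\}_{g,x\in G}$, product $(\delta_g\overline{x})(\delta_h\overline{y})=\beta_g(x,y)\,\delta_g\overline{xy}$ if $h=x^{-1}gx$ and $0$ otherwise, coproduct $\Delta(\delta_g\overline{x})=\sum_{hl=g}\gamma_x(h,l)\,\delta_h\overline{x}\otimes\delta_l\overline{x}$, associator $\sum\omega(g,h,l)^{-1}\delta_g\overline{e}\otimes\delta_h\overline{e}\otimes\delta_l\overline{e}$, and $R$-matrix $\sum_{g,h}\delta_g\overline{e}\otimes\delta_h\overline{g}$. $\operatorname{Rep}(D^\omega(G))$ (finite-dimensional modules) is a modular category, braided equivalent to the center of $\operatorname{Vec}_G^\omega$. Let $R$ be a set of representatives of the conjugacy classes of $G$ and $K_a$ the conjugacy class of $a$. A $\beta_a$-character of $C_G(a)$ is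 the trace function of a finite-dimensional module over the twisted group algebra $k^{\beta_a}[C_G(a)]$ (basis $\overline{x}$, $\overline{x}\,\overline{y}=\beta_a(x,y)\overline{xy}$); $\deg\chi=\chi(e)$. Isomorphism classes of simple objects are identified with pairs $(a,\chi)$, $a\in R$, $\chi$ an irreducible $\beta_a$-character of $C_G(a)$: $(a,\chi)$ is the simple module $M$ with $\delta_a\overline{e}M\ne0$ on which $\operatorname{span}\{\delta_a\overline{x}:x\in C_G(a)\}\cong k^{\beta_a}[C_G(a)]$ acts on $\delta_a\overline{e}M$ with character $\chi$. The categorical dimension and twist of $(a,\chi)$ are $d(a,\chi)=|K_a|\deg\chi$ and $\theta(a,\chi)=\chi(a)/\deg\chi$. For normal subgroups $K,H$ of $G$ that centralize each other (commute elementwise), $B:K\times H\to k^\times$ is an $\omega$-bicharacter if $B(x,yz)=\beta_x(y,z)^{-1}B(x,y)B(x,z)$ and $B(wx,y)=\beta_y(w,x)B(w,y)B(x,y)$ for all $w,x\in K$, $y,z\in H$; it is $G$-invariant if $B(x^{-1}kx,h)=\frac{\beta_k(x,h)\beta_k(xh,x^{-1})}{\beta_k(x,x^{-1})}B(k,xhx^{-1})$ for all $x\in G,k\in K,h\in H$. $\mathcal{S}(K,H,B)$ is the full subcategory of $\operatorname{Rep}(D^\omega(G))$ whose objects are the finite direct sums of simple objects $(a,\chi)$ with $a\in K\cap R$ and $\chi(h)=B(a,h)\deg\chi$ for all $h\in H$; it is a fusion subcategory. For a fusion subcategory $\mathcal{D}$ with set $\operatorname{Irr}(\mathcal{D})$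 of isomorphism classes of simple objects: $\dim(\mathcal{D})=\sum_{X\in\operatorname{Irr}(\mathcal{D})}d(X)^2$, the Gauss sum is $\tau(\mathcal{D})=\sum_{X\in\operatorname{Irr}(\mathcal{D})}\theta(X)d(X)^2$, and the central charge is $\zeta(\mathcal{D})=\tau(\mathcal{D})/\sqrt{\dim(\mathcal{D})}$ (scalars are regarded as complex numbers and square roots of positive integers are positive). $\mathcal{D}$ is nondegenerate if the only objects $X\in\mathcal{D}$ with $c_{Y,X}c_{X,Y}=\mathrm{id}$ for all $Y\in\mathcal{D}$ ($c$ the braiding) are direct sums of the unit object. *)

(* Defs.v *)
From HB Require Import structures.
From mathcomp Require Import all_boot all_order all_algebra all_fingroup.
From mathcomp Require Import all_field.
From mathcomp Require Import boolp classical_sets functions cardinality fsbigop.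

Set Implicit Arguments.
Unset Strict Implicit.
Unset Printing Implicit Defensive.

Import Order.TTheory GRing.Theory Num.Theory.
Local Open Scope ring_scope.

Section TwistedDouble.

Variables (k : closedFieldType) (gT : finGroupType).
Implicit Types (omega : gT -> gT -> gT -> k) (B : gT -> gT -> k) (K H : {group gT}).

(* The finite group G is the whole of gT; a ^ x is x^-1 * a * x. *)

Definition normalized_3cocycle omega : Prop :=
  [/\ forall g1 g2 g3 : gT, omega g1 g2 g3 != 0,
      forall g1 g2 g3 g4 : gT,
        omega g2 g3 g4 * omega g1 (g2 * g3)%g g4 * omega g1 g2 g3
        = omega (g1 * g2)%g g3 g4 * omega g1 g2 (g3 * g4)%g
    & forall g l : gT, omega g 1%g l = 1].

Definition beta omega (a x y : gT) : k :=
  omega a x y * omega x y (a ^ (x * y))%g / omega x (a ^ x)%g y.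

(* An n-dimensional left module is given by n x n matrices acting on column
   vectors. *)
Definition mx_irreducible n (S : 'M[k]_n -> Prop) : Prop :=
  (0 < n)%N /\
  forall U : {vspace 'cV[k]_n},
    (forall A u, S A -> u \in U -> A *m u \in U) -> U = 0%VS \/ U = fullv.

Section TwistedGroupAlgebra.

Variables (omega : gT -> gT -> gT -> k) (a : gT).

(* Modules over k^{beta_a}[C_G(a)]; s x is the action of the basis element of
   x, for x in C_G(a). *)
Definition beta_repr m (s : gT -> 'M[k]_m) : Prop :=
  s 1%g = 1%:M /\
  {in 'C[a]%g &, forall x y, s x *m s y = beta omega a x y *: s (x * y)%g}.

(* Functions on C_G(a) are represented by their extension by 0 to G. *)
Definition trace_char m (s : gT -> 'M[k]_m) : {ffun gT -> k} :=
  [ffun x => if x \in 'C[a]%g then \tr (s x) else 0].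

Definition irr_beta_char (chi : {ffun gT -> k}) : Prop :=
  exists (m : nat) (s : gT -> 'M[k]_m),
    [/\ beta_repr s,
        mx_irreducible (fun A => exists2 x, x \in 'C[a]%g & A = s x)
      & chi = trace_char s].

End TwistedGroupAlgebra.

(* Finite-dimensional D^omega(G)-modules: act g x is the action of the basis
   element delta_g xbar; the unit of D^omega(G) is \sum_g delta_g 1bar. *)
Record dmod omega := DMod {
  dmod_dim : nat;
  act : gT -> gT -> 'M[k]_dmod_dim;
  act_unit : \sum_(g : gT) act g 1%g = 1%:M;
  act_mul : forall g x h y : gT,
    act g x *m act h y
    = if h == (g ^ x)%g then beta omega g x y *: act g (x * y)%g else 0
}.

Section Modules.

Variable omega : gT -> gT -> gT -> k.
Implicit Types (M X Y : dmod omega) (D : dmod omega -> Prop).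

Definition dhom M X (f : 'M[k]_(dmod_dim X, dmod_dim M)) : Prop :=
  forall g x : gT, f *m act M g x = act X g x *m f.

Definition simple M : Prop :=
  mx_irreducible (fun A => exists g x : gT, A = act M g x).

(* M is a biproduct of the modules N 0, ..., N (r-1) (the zero module if
   r = 0). *)
Definition is_direct_sum M r (N : 'I_r -> dmod omega) : Prop :=
  exists (inj : forall i, 'M[k]_(dmod_dim M, dmod_dim (N i)))
         (prj : forall i, 'M[k]_(dmod_dim (N i), dmod_dim M)),
    [/\ forall i, dhom (inj i) /\ dhom (prj i),
        forall i, prj i *m inj i = 1%:M,
        forall i j, i != j -> prj i *m inj j = 0
      & \sum_i inj i *m prj i = 1%:M].

(* Labels of simple objects. *)
Definition label : Type := (gT * {ffun gT -> k})%type.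

(* M is the simple object (a, chi): the columns of E form a basis of
   delta_a 1bar M, and s is the action of C_G(a) on it in this basis. *)
Definition has_label M (X : label) : Prop :=
  [/\ simple M, act M X.1 1%g != 0
    & exists (m : nat) (E : 'M[k]_(dmod_dim M, m)) (s : gT -> 'M[k]_m),
        [/\ row_full E, (E^T == (act M X.1 1%g)^T)%MS,
            {in 'C[X.1]%g, forall x, act M X.1 x *m E = E *m s x}
          & X.2 = trace_char X.1 s]].

(* X (x) Y is modelled by 'M_(dim X, dim Y), with x (x) y := x *m y^T. Then
   A (x) A' is T |-> A *m T *m A'^T, the flip is the transposition, and
   c_{X,Y} is the action of the R-matrix
   \sum_(g, h) delta_g 1bar (x) delta_h gbar followed by the flip. *)
Definition braiding X Y (T : 'M[k]_(dmod_dim X, dmod_dim Y)) :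
    'M[k]_(dmod_dim Y, dmod_dim X) :=
  (\sum_(g : gT) \sum_(h : gT) act X g 1%g *m T *m (act Y h g)^T)^T.

(* The trivial module of the counit delta_g xbar |-> [g = 1]. *)
Definition is_unit_object X : Prop :=
  dmod_dim X = 1%N /\ forall g x : gT, act X g x = (g == 1%g)%:R%:M.

(* A full subcategory is given by its class of objects. *)
Definition nondegenerate_subcat D : Prop :=
  forall X, D X ->
    (forall Y, D Y ->
       forall T : 'M[k]_(dmod_dim X, dmod_dim Y),
         braiding (braiding T) = T) ->
    exists (r : nat) (N : 'I_r -> dmod omega),
      is_direct_sum X N /\ forall i, is_unit_object (N i).

(* In the sequel R is a set of representatives of the conjugacy classes. *)
Variable R : {set gT}.

Definition Irr D : set label :=
  [set X : label | [/\ X.1 \in R, irr_beta_char omega X.1 X.2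
                     & exists2 M, D M & has_label M X]]%classic.

Definition deg (chi : {ffun gT -> k}) : k := chi 1%g.

Definition cat_dim (X : label) : k := #|(X.1 ^: [set: gT])%g|%:R * deg X.2.

Definition twist (X : label) : k := X.2 X.1 / deg X.2.

Definition global_dim D : k := \sum_(X \in Irr D) cat_dim X ^+ 2.

Definition gauss_sum D : k := \sum_(X \in Irr D) twist X * cat_dim X ^+ 2.

(* The embedding iota of the complex algebraic numbers in k says which square
   root is positive. *)
Definition pos_sqrt (iota : {rmorphism algC -> k}) (x : k) : k :=
  xget 0 [set s : k | s ^+ 2 = x /\ exists2 r : algC, 0 <= r & s = iota r]%classic.

Definition central_charge (iota : {rmorphism algC -> k}) D : k :=
  gauss_sum D / pos_sqrt iota (global_dim D).

Definition S_label K H B (X : label) : Prop :=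
  X.1 \in K :&: R /\ {in H, forall h, X.2 h = B X.1 h * deg X.2}.

Definition S_cat K H B M : Prop :=
  exists (r : nat) (N : 'I_r -> dmod omega),
    is_direct_sum M N /\
    forall i, exists2 X : label, S_label K H B X & has_label (N i) X.

End Modules.

(* Only the values of B on K x H matter. *)
Definition omega_bichar omega K H B : Prop :=
  [/\ {in K & H, forall x y, B x y != 0},
      {in K, forall x, {in H &, forall y z,
        B x (y * z)%g = (beta omega x y z)^-1 * B x y * B x z}}
    & {in K &, forall v x, {in H, forall y,
        B (v * x)%g y = beta omega y v x * B v y * B x y}}].

Definition G_invariant omega K H B : Prop :=
  forall x : gT, {in K & H, forall l h,
    B (l ^ x)%g h
    = beta omega l x h * beta omega l (x * h)%g x^-1%g / beta omega l x x^-1%g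
      * B l (h ^ x^-1)%g}.

End TwistedDouble.

(* Main.v *)
(** For a in K and R, the pairs (a, chi) in Irr(S(K,H,B)) are those where chi is an
irreducible beta_a-character of C_G(a) lying over the linear beta_a-character
B(a,-) of H. The sum of chi(e) chi over these chi is the character of the module
induced from B(a,-): it is [C_G(a):H] B(a,-) on H and vanishes outside H. Its
values at a and at e give the Gauss sum, as theta(a,chi) d(a,chi)^2 =
|K_a|^2 chi(e) chi(a), and the dimension |G| |K| / |H|. That induced character is
computed by cutting the regular one, the sum of all chi(e) chi, with the central
idempotent |H|^-1 sum_h B(a,h)^-1 h, which acts on chi as 1 or 0.

Objects (e, chi) with chi trivial on KH centralize S(K,H,B), whose objects are
graded by K. If S(K,H,B) is nondegenerate, such a chi is therefore trivial, and
the same induced character for KH in place of H gives G = KH. Then |G|/|H| =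
|K|/|K cap H|; moreover a |-> B(a,a) is a class function. *)

Require Import Defs.
From HB Require Import structures.
From mathcomp Require Import all_boot all_order all_algebra all_fingroup.
From mathcomp Require Import all_field.
From mathcomp Require Import boolp classical_sets functions cardinality fsbigop.
From mathcomp Require Import ring.

Set Implicit Arguments.
Unset Strict Implicit.
Unset Printing Implicit Defensive.

Import Order.TTheory GRing.Theory Num.Theory.
Local Open Scope ring_scope.

(** * Irreducible sets of matrices *)

Section Schur.

Variable k : closedFieldType.

Lemma mulmx_linfunE m n (f : 'M[k]_(m, n)) (u : 'cV[k]_n) :
  linfun (mulmx f) u = f *m u.
Proof. exact: lfunE. Qed.

(** The relation [f *m A = A' *m f] makes the kernel of [f] stable under [S], hence zero or
    everything. *)
Lemma irreducible_ker n m (S : 'M[k]_n -> Prop) (f : 'M[k]_(m, n)) :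
    mx_irreducible S -> (forall A, S A -> exists A', f *m A = A' *m f) ->
  f = 0 \/ forall u : 'cV_n, f *m u = 0 -> u = 0.
Proof.
move=> [_ irrS] comm; case: (irrS (lker (linfun (mulmx f)))) => [A u SA|ker0|kerT].
- rewrite !memv_ker !mulmx_linfunE => /eqP fu0; have [A' fA] := comm A SA.
  by rewrite mulmxA fA -mulmxA fu0 mulmx0.
- right=> u fu0; apply/eqP; rewrite -memv0 -ker0 memv_ker mulmx_linfunE.
  exact/eqP.
left; apply/matrixP=> i j; rewrite mxE.
have := memvf (delta_mx j 0 : 'cV[k]_n); rewrite -kerT memv_ker mulmx_linfunE.
by move/eqP/matrixP/(_ i 0); rewrite -colE !mxE.
Qed.

(** Dually, the image of [f] is stable; if it is everything, preimages of the basis vectors are the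
    columns of a right inverse. *)
Lemma irreducible_im n m (S : 'M[k]_n -> Prop) (f : 'M[k]_(n, m)) :
    mx_irreducible S -> (forall A, S A -> exists A', A *m f = f *m A') ->
  f = 0 \/ exists g, f *m g = 1%:M.
Proof.
move=> [_ irrS] comm; case: (irrS (limg (linfun (mulmx f)))) => [A u0 SA|im0|imT].
- case/memv_imgP=> u _ ->; rewrite mulmx_linfunE; have [A' Af] := comm A SA.
  by rewrite mulmxA Af -mulmxA -mulmx_linfunE memv_img ?memvf.
- left; apply/matrixP=> i j; rewrite mxE.
  have := memv_img (linfun (mulmx f)) (memvf (delta_mx j 0 : 'cV[k]_m)).
  rewrite im0 memv0 mulmx_linfunE.
  by move/eqP/matrixP/(_ i 0); rewrite -colE !mxE.
right; have /fin_all_exists[g gP] (j : 'I_n) :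
    exists u : 'cV[k]_m, f *m u = delta_mx j 0.
  have : (delta_mx j 0 : 'cV[k]_n) \in limg (linfun (mulmx f)).
    by rewrite imT memvf.
  by case/memv_imgP=> u _ ->; exists u; rewrite mulmx_linfunE.
exists (\matrix_(i, j) g j i 0); apply/matrixP=> i j.
have /matrixP/(_ i 0) := gP j; rewrite !mxE andbT => <-.
by apply: eq_bigr => l _; rewrite mxE.
Qed.

Lemma irreducible_iso n m (S : 'M[k]_n -> Prop) (S' : 'M[k]_m -> Prop)
    (f : 'M[k]_(m, n)) :
    mx_irreducible S -> mx_irreducible S' ->
    (forall A, S A -> exists A', f *m A = A' *m f) ->
    (forall A', S' A' -> exists A, A' *m f = f *m A) ->
  f = 0 \/ exists g, f *m g = 1%:M /\ g *m f = 1%:M.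
Proof.
move=> irrS irrS' comm comm'.
case: (irreducible_ker irrS comm) => [|inj_f]; first by left.
case: (irreducible_im irrS' comm') => [|[g fg1]]; [by left | right].
exists g; split=> //; apply/subr0_eq; apply/matrixP=> i j; rewrite [RHS]mxE.
have /inj_f/matrixP/(_ i 0) : f *m col j (g *m f - 1%:M) = 0.
  by rewrite colE mulmxA mulmxBr mulmxA fg1 mul1mx mulmx1 subrr mul0mx.
by rewrite !mxE.
Qed.

(** Schur's lemma: [k] is algebraically closed, so [f] has an eigenvalue [c], and [f - c%:M]
    commutes with [S] and is not injective. *)
Lemma irreducible_scalar n (S : 'M[k]_n -> Prop) (f : 'M[k]_n) :
  mx_irreducible S -> (forall A, S A -> f *m A = A *m f) -> exists c, f = c%:M.
Proof.
move=> irrS comm; have [n_gt0 _] := irrS.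
(* Eigenvectors in the library are rows, whereas matrices act on columns here; hence the
   transpose. *)
have [c] : exists c, root (char_poly f^T) c.
  by apply/closed_rootP; rewrite size_char_poly; case: (n) n_gt0.
rewrite -eigenvalue_root_char => /eigenvalueP[v vf vn0]; exists c.
have commc A : S A -> exists A', (f - c%:M) *m A = A' *m (f - c%:M).
  by move=> SA; exists A; rewrite mulmxBl mulmxBr comm // scalar_mxC.
case: (irreducible_ker irrS commc) => [/subr0_eq//|/(_ v^T)].
rewrite mulmxBl mul_scalar_mx -[f]trmxK -trmx_mul vf linearZ subrr => /(_ erefl).
by move/(canRL (@trmxK _ _ _)); rewrite trmx0 => v0; rewrite v0 eqxx in vn0.
Qed.

(** In a rank factorization q = EF, the relation EFEF = EF can be cancelled by E on the left and by
    F on the right, leaving FE = 1. *)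
Lemma idempotent_split n (q : 'M[k]_n) : q *m q = q ->
  exists r (E : 'M[k]_(n, r)) (F : 'M[k]_(r, n)),
    [/\ r = \rank q, E *m F = q & F *m E = 1%:M].
Proof.
move=> qq; move: (col_base q) (row_base q) (col_base_full q)
  (row_base_free q) (mulmx_base q).
move=> E F fullE freeF EF; exists (\rank q), E, F; split=> //.
apply: (row_full_inj fullE); apply: (row_free_inj freeF).
by rewrite mulmx1 mulmxA EF -mulmxA EF.
Qed.

Lemma vspace_projection n (U : {vspace 'cV[k]_n}) :
  exists q : 'M[k]_n, forall u, q *m u = projv U u.
Proof.
exists (\matrix_(i, j) projv U (delta_mx j 0) i 0) => u.
rewrite {2}[u]matrix_sum_delta linear_sum; apply/colP=> i.
rewrite mxE summxE; apply: eq_bigr => j _.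
by rewrite big_ord1 linearZ !mxE mulrC.
Qed.

Lemma mulmx_cV_inj m n (A A' : 'M[k]_(m, n)) :
  (forall u : 'cV_n, A *m u = A' *m u) -> A = A'.
Proof.
move=> eqA; apply/matrixP=> i j.
by have /matrixP/(_ i 0) := eqA (delta_mx j 0); rewrite -!colE !mxE.
Qed.

(* A module that is not irreducible is, up to an idempotent q, block
   triangular. *)
Lemma reducible_split n (S : 'M[k]_n -> Prop) :
    (0 < n)%N -> ~ mx_irreducible S ->
  exists q : 'M[k]_n, [/\ q *m q = q, forall A, S A -> q *m A *m q = A *m q,
    (\rank q < n)%N & (\rank (1%:M - q)%R < n)%N].
Proof.
move=> n_gt0 redS.
have [U [stU U0 UT]] : exists U : {vspace 'cV[k]_n},
    [/\ forall A u, S A -> u \in U -> A *m u \in U, U <> 0%VS & U <> fullv].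
  apply: contrapT => noU; apply: redS; split=> // U stU.
  apply: contrapT => /not_orP[U0 UT]; apply: noU; by exists U.
(* [q] projects onto the proper nonzero stable subspace [U], so neither [q] nor [1 - q] is the
   identity. *)
have [q qE] := vspace_projection U.
have qU u : q *m u \in U by rewrite qE memv_proj.
have qid u : u \in U -> q *m u = u by rewrite qE; exact: projv_id.
have qq : q *m q = q.
  by apply: mulmx_cV_inj => u; rewrite -mulmxA qid.
have rank_idem (p : 'M[k]_n) : p *m p = p -> p <> 1%:M -> (\rank p < n)%N.
  move=> pp p1; rewrite ltn_neqAle rank_leq_row andbT; apply/negP=> rkp.
  apply: p1; apply: (row_free_inj (A := p)); first by rewrite /row_free.
  by rewrite pp mul1mx.
exists q; split=> //.
- by move=> A SA; apply: mulmx_cV_inj => u; rewrite -!mulmxA qid // stU.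
- apply: (rank_idem _ qq) => q1; apply: UT; apply/eqP.
  rewrite eqEsubv subvf; apply/subvP=> u _.
  by rewrite -[u]mul1mx -q1.
apply: (rank_idem (1%:M - q)) => [|q1].
  by rewrite mulmxBl mul1mx mulmxBr mulmx1 qq subrr subr0.
have q0 : q = 0 by rewrite -[q](subKr 1%:M) q1 subrr.
apply: U0; apply/eqP; rewrite -subv0; apply/subvP=> u /qid.
by rewrite q0 mul0mx => <-; exact: mem0v.
Qed.

End Schur.

(** * Characters of projective representations *)

Section FinTypeMatrices.

Variables (k : closedFieldType) (T : finType).
Implicit Types f g : T -> T -> k.

Definition fin_mx f : 'M[k]_#|T| := \matrix_(i, j) f (enum_val i) (enum_val j).

Lemma fin_mxM f g :
  fin_mx f *m fin_mx g = fin_mx (fun x z => \sum_y f x y * g y z).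
Proof.
apply/matrixP=> i j; rewrite !mxE [RHS]big_enum_val.
by apply: eq_bigr => l _; rewrite !mxE.
Qed.

Lemma fin_mx1 : fin_mx (fun x y => (x == y)%:R) = 1%:M.
Proof. by apply/matrixP=> i j; rewrite !mxE (inj_eq enum_val_inj). Qed.

Lemma mxtrace_fin_mx f : \tr (fin_mx f) = \sum_x f x x.
Proof. by rewrite [RHS]big_enum_val; apply: eq_bigr => i _; rewrite mxE. Qed.

Lemma eq_fin_mx f g : (forall x y, f x y = g x y) -> fin_mx f = fin_mx g.
Proof. by move=> fg; apply/matrixP=> i j; rewrite !mxE. Qed.

Lemma fin_mxZ c f : c *: fin_mx f = fin_mx (fun x y => c * f x y).
Proof. by apply/matrixP=> i j; rewrite !mxE. Qed.

End FinTypeMatrices.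

Section ProjectiveRepresentations.

Variables (k : closedFieldType) (gT : finGroupType) (C : {group gT}).
Variable al : gT -> gT -> k.

(** For [C] = C_G(a) and [al] = beta_a, this and the following notions are convertible to
    [beta_repr], [trace_char] and [irr_beta_char]. *)
Definition proj_repr m (s : gT -> 'M[k]_m) : Prop :=
  s 1%g = 1%:M /\ {in C &, forall x y, s x *m s y = al x y *: s (x * y)%g}.

Definition proj_char m (s : gT -> 'M[k]_m) : {ffun gT -> k} :=
  [ffun x => if x \in C then \tr (s x) else 0].

Definition proj_irr m (s : gT -> 'M[k]_m) : Prop :=
  mx_irreducible (fun A => exists2 x, x \in C & A = s x).

Definition irr_proj_char (chi : {ffun gT -> k}) : Prop :=
  exists (m : nat) (s : gT -> 'M[k]_m),
    [/\ proj_repr s, proj_irr s & chi = proj_char s].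

Lemma proj_charE m (s : gT -> 'M[k]_m) : {in C, proj_char s =1 fun x => \tr (s x)}.
Proof. by move=> x Cx; rewrite ffunE Cx. Qed.

Lemma proj_char1 m (s : gT -> 'M[k]_m) : proj_repr s -> proj_char s 1%g = m%:R.
Proof. by case=> s1 _; rewrite proj_charE // s1 mxtrace1. Qed.

(** Induction on the dimension: a proper nonzero submodule and its quotient have characters adding
    up to that of [s]. The list thus holds the composition factors. *)
Lemma proj_char_decomposition m (s : gT -> 'M[k]_m) : proj_repr s ->
  exists L : seq {ffun gT -> k}, {in L, forall chi, irr_proj_char chi} /\
    forall x, proj_char s x = \sum_(chi <- L) chi x.
Proof.
have [n] := ubnP m; elim: n => // n IHn in m s * => /ltnSE-lemn [s1 sM].
have [m0 | m_gt0] := posnP m.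
  exists [::]; split=> // x; rewrite ffunE big_nil; case: ifP => // _.
  by apply: big1 => -[i lti] _; exfalso; rewrite m0 in lti.
have [irr_s | red_s] := pselect (proj_irr s).
  exists [:: proj_char s]; split=> [chi | x]; last by rewrite big_seq1.
  by rewrite inE => /eqP->; exists m, s.
have [q [qq qsq rq rq']] := reducible_split m_gt0 red_s.
have {}qsq x : x \in C -> q *m s x *m q = s x *m q by move=> Cx; apply: qsq; exists x.
have qq' : (1%:M - q) *m (1%:M - q) = 1%:M - q.
  by rewrite mulmxBl mul1mx mulmxBr mulmx1 qq subrr subr0.
have [r [E [F [def_r EF FE]]]] := idempotent_split qq.
have [r' [E' [F' [def_r' EF' FE']]]] := idempotent_split qq'.
(* The submodule im q, in the coordinates given by [E] and [F]. *)
have repr1 : proj_repr (fun x => F *m s x *m E).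
  split=> [|x y Cx Cy]; first by rewrite s1 mulmx1.
  have Eq : q *m E = E by rewrite -EF -mulmxA FE mulmx1.
  have qsE : q *m (s y *m E) = s y *m E.
    by rewrite -Eq (mulmxA (s y)) -qsq // -!mulmxA (mulmxA q q) qq.
  rewrite scalemxAl scalemxAr -sM // !mulmxA -(mulmxA (F *m s x)) EF.
  by rewrite -!mulmxA qsE.
(* The quotient by im q, realized on im (1 - q); it is multiplicative because (1 - q) s(x) q = 0. *)
have repr2 : proj_repr (fun x => F' *m s x *m E').
  split=> [|x y Cx Cy]; first by rewrite s1 mulmx1.
  have Fq : F' = F' *m (1%:M - q) by rewrite -EF' mulmxA FE' mul1mx.
  have Fsq z : z \in C -> F' *m s z *m q = 0.
    move=> Cz; rewrite Fq -!mulmxA -qsq // !mulmxA -(mulmxA F' _ q).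
    by rewrite mulmxBl mul1mx qq subrr mulmx0 !mul0mx.
  rewrite scalemxAl scalemxAr -sM // !mulmxA; congr (_ *m _).
  by rewrite -(mulmxA _ E') EF' mulmxBr mulmx1 Fsq // subr0.
have [|L1 [irrL1 sumL1]] := IHn _ _ _ repr1.
  by rewrite def_r; exact: leq_trans rq lemn.
have [|L2 [irrL2 sumL2]] := IHn _ _ _ repr2.
  by rewrite def_r'; exact: leq_trans rq' lemn.
exists (L1 ++ L2); split=> [chi | x].
  by rewrite mem_cat => /orP[]; [apply: irrL1 | apply: irrL2].
rewrite big_cat /= -sumL1 -sumL2 !ffunE; case: ifP => [Cx|_]; last by rewrite addr0.
rewrite -!mulmxA !(mxtrace_mulC (_ : 'M_(_, m))) -!mulmxA EF EF'.
by rewrite -mxtraceD -mulmxDr addrC subrK mulmx1.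
Qed.

(** * Orthogonality relations for twisted characters *)

Hypothesis char0 : [pchar k] =i pred0.
Hypothesis al_neq0 : {in C &, forall x y, al x y != 0}.
Hypothesis alM : {in C & &, forall x y z,
  al x y * al (x * y)%g z = al y z * al x (y * z)%g}.
Hypothesis al1g : forall x, al 1%g x = 1.
Hypothesis alg1 : forall x, al x 1%g = 1.

Let natr_neq0 n : (n%:R == 0 :> k) = (n == 0)%N.
Proof. by have /pcharf0P-> := char0. Qed.

Definition proj_inv m (s : gT -> 'M[k]_m) x := (al x x^-1%g)^-1 *: s x^-1%g.

Lemma proj_invr m (s : gT -> 'M[k]_m) x :
  proj_repr s -> x \in C -> s x *m proj_inv s x = 1%:M.
Proof.
move=> [s1 sM] Cx; rewrite -scalemxAr sM ?groupV // mulgV s1 scalerA.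
by rewrite mulVf ?scale1r // al_neq0 ?groupV.
Qed.

Lemma proj_invl m (s : gT -> 'M[k]_m) x :
  proj_repr s -> x \in C -> proj_inv s x *m s x = 1%:M.
Proof. by move=> rs Cx; apply/mulmx1C/proj_invr. Qed.

Lemma proj_invM m (s : gT -> 'M[k]_m) x y :
    proj_repr s -> x \in C -> y \in C ->
  al x y *: (proj_inv s y *m proj_inv s x) = proj_inv s (x * y)%g.
Proof.
move=> rs Cx Cy; have [_ sM] := rs.
move: (proj_invl rs Cx) (proj_invl rs Cy) (proj_invr rs (groupM Cx Cy)).
move: (proj_inv s x) (proj_inv s y) (proj_inv s _) => ix iy ixy ixK iyK xyK.
rewrite -[LHS]mulmx1 -xyK mulmxA -scalemxAl scalemxAr -sM // mulmxA.
by rewrite -(mulmxA iy) ixK mulmx1 iyK mul1mx.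
Qed.

Definition proj_average m n (s : gT -> 'M[k]_m) (t : gT -> 'M[k]_n) X :=
  \sum_(x in C) s x *m X *m proj_inv t x.

(** Averaging turns any [X] into an intertwiner from [t] to [s]: on replacing x by yx, the factors
    [al y x] of [s] and of the inverse of [t] cancel. *)
Lemma proj_average_hom m n (s : gT -> 'M[k]_m) (t : gT -> 'M[k]_n) X y :
    proj_repr s -> proj_repr t -> y \in C ->
  s y *m proj_average s t X = proj_average s t X *m t y.
Proof.
move=> rs rt Cy; have [_ sM] := rs.
rewrite {2}/proj_average (reindex_inj (mulgI y)) mulmx_sumr mulmx_suml /=.
apply: eq_big => [x | x Cx]; first by rewrite groupMl.
rewrite !mulmxA sM // -proj_invM //; move: (proj_invl rt Cy).
move: (proj_inv t x) (proj_inv t y) => ix iy iyK.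
rewrite -!scalemxAl -!scalemxAr -scalemxAl; congr (_ *: _).
by rewrite !mulmxA -(mulmxA _ iy) iyK mulmx1.
Qed.

Lemma mulmx_delta_diag m n (A : 'M[k]_m) (A' : 'M[k]_n) i j :
  (A *m delta_mx i j *m A') i j = A i i * A' j j.
Proof.
rewrite -(mul_delta_mx (0 : 'I_1) i j) mulmxA -colE -mulmxA -rowE.
by rewrite !mxE big_ord1 !mxE.
Qed.

(** If [psi] is the character of [t], the second factor is the trace of the inverse of [t x], which
    replaces the complex conjugate of psi(x). *)
Definition proj_dot (chi psi : {ffun gT -> k}) :=
  \sum_(x in C) chi x * ((al x x^-1%g)^-1 * psi x^-1%g).

(** A product of traces tr(A) tr(A') is the sum over i, j of the (i, j) entries of A E_ij A', where
    E_ij is a matrix unit. *)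
Lemma proj_dotE m n (s : gT -> 'M[k]_m) (t : gT -> 'M[k]_n) :
  proj_dot (proj_char s) (proj_char t)
  = \sum_i \sum_j proj_average s t (delta_mx i j) i j.
Proof.
under eq_bigr => i _.
  under eq_bigr => j _.
    rewrite summxE; under eq_bigr => x _ do rewrite mulmx_delta_diag; over.
  rewrite exchange_big; over.
rewrite exchange_big; apply: eq_bigr => x Cx.
rewrite !proj_charE ?groupV // -mxtraceZ mulr_suml.
by apply: eq_bigr => i _; rewrite mulr_sumr.
Qed.

(** By Schur's lemma a nonzero average would be an isomorphism, and the two characters would
    agree. *)
Lemma proj_dot_neq m n (s : gT -> 'M[k]_m) (t : gT -> 'M[k]_n) :
    proj_repr s -> proj_irr s -> proj_repr t -> proj_irr t ->
  proj_char s <> proj_char t -> proj_dot (proj_char s) (proj_char t) = 0.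
Proof.
move=> rs irrs rt irrt neq; rewrite proj_dotE; apply: big1 => i _; apply: big1 => j _.
have hom y Cy := proj_average_hom (delta_mx i j) rs rt (y := y) Cy.
case: (irreducible_iso (f := proj_average s t (delta_mx i j)) irrt irrs).
- by move=> _ [y Cy ->]; exists (s y); rewrite hom.
- by move=> _ [y Cy ->]; exists (t y); rewrite hom.
- by move->; rewrite mxE.
case=> g [fg gf]; case: neq; apply/ffunP=> x; rewrite !ffunE; case: ifP => // Cx.
by rewrite -[s x]mulmx1 -fg mulmxA hom // -mulmxA mxtrace_mulC -mulmxA gf mulmx1.
Qed.

Lemma proj_dot_eq m (s : gT -> 'M[k]_m) :
    proj_repr s -> proj_irr s ->
  proj_dot (proj_char s) (proj_char s) = #|C|%:R.
Proof.
move=> rs irrs; have m_neq0 : m%:R != 0 :> k by rewrite natr_neq0 -lt0n; case: irrs.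
(* The average is scalar by Schur's lemma, and its trace is |C| tr(X); characteristic zero allows
   division by m. *)
have avg (X : 'M[k]_m) : proj_average s s X = (#|C|%:R * \tr X / m%:R)%:M.
  have [|c cE] := irreducible_scalar (f := proj_average s s X) irrs.
    by move=> _ [y Cy ->]; rewrite proj_average_hom.
  rewrite cE; congr (_%:M); apply: (mulIf m_neq0); rewrite divfK // mulr_natr.
  rewrite -mxtrace_scalar -cE raddf_sum /= mulr_natl -sumr_const.
  by apply: eq_bigr => x Cx; rewrite mxtrace_mulC mulmxA proj_invl // mul1mx.
have trd (i j : 'I_m) : \tr (delta_mx i j : 'M[k]_m) = (i == j)%:R.
  rewrite /mxtrace (bigD1 i) //= big1 => [|l /negPf il].
    by rewrite mxE eqxx addr0.
  by rewrite mxE il.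
rewrite proj_dotE; transitivity (\sum_(i < m) (#|C|%:R / m%:R : k)).
  apply: eq_bigr => i _; rewrite (bigD1 i) //= big1 => [|j /negPf ji].
    by rewrite avg mxE trd eqxx mulr1 addr0 mulr1n.
  by rewrite avg trd eq_sym ji mulr0 mul0r mxE mul0rn.
by rewrite sumr_const card_ord -[LHS]mulr_natr divfK.
Qed.

Lemma irr_proj_dot chi psi : irr_proj_char chi -> irr_proj_char psi ->
  proj_dot chi psi = (chi == psi)%:R * #|C|%:R.
Proof.
move=> [m [s [rs irrs ->]]] [n [t [rt irrt ->]]].
case: eqP => [<- | neq]; first by rewrite mul1r proj_dot_eq.
by rewrite mul0r proj_dot_neq.
Qed.

(** The left regular module of the twisted group algebra: the basis vector of v goes to [al x v]
    times that of xv. *)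
Definition proj_reg (x : gT) : 'M[k]_#|subg_of C| :=
  fin_mx (fun u v : subg_of C =>
            if (x * sgval v)%g == sgval u then al x (sgval v) else 0).

Lemma proj_reg_repr : proj_repr proj_reg.
Proof.
split=> [|x y Cx Cy].
  rewrite -fin_mx1; apply: eq_fin_mx => u v; rewrite mul1g al1g eq_sym.
  by rewrite (inj_eq subg_inj); case: eqP.
rewrite fin_mxM fin_mxZ; apply: eq_fin_mx => u v.
have Cyv : (y * sgval v)%g \in C by rewrite groupM ?subgP.
rewrite (bigD1 (subg C (y * sgval v)%g)) //= big1 => [|w neq].
  rewrite subgK // eqxx addr0 mulgA; case: ifP => _; last by rewrite mul0r mulr0.
  by rewrite mulrC -alM ?subgP.
case: (y * sgval v =P sgval w)%g => [e|]; last by rewrite mulr0.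
by rewrite e sgvalK eqxx in neq.
Qed.

Lemma proj_reg_char x : proj_char proj_reg x = (x == 1%g)%:R * #|C|%:R.
Proof.
rewrite ffunE; case: ifPn => [Cx | nCx]; last first.
  by case: eqP nCx => [-> | _]; rewrite ?group1 ?mul0r.
rewrite mxtrace_fin_mx; case: eqP => [-> | /eqP x1].
  rewrite mul1r (eq_bigr (fun=> 1)) => [|v _]; last by rewrite mul1g eqxx al1g.
  by rewrite sumr_const card_sub.
rewrite mul0r big1 // => v _; case: eqP => // /(canRL (mulgK _)).
by rewrite mulgV => xe; rewrite xe eqxx in x1.
Qed.

(** The list consists of the composition factors of the regular module, each kept once; every
    irreducible chi occurs there, with multiplicity chi(1). *)
Lemma irr_proj_chars : exists L : seq {ffun gT -> k},
  [/\ uniq L, forall chi, chi \in L <-> irr_proj_char chi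
    & forall x, \sum_(chi <- L) chi 1%g * chi x = (x == 1%g)%:R * #|C|%:R].
Proof.
have C_neq0 : #|C|%:R != 0 :> k by rewrite natr_neq0 -lt0n cardG_gt0.
have [L [irrL sumL]] := proj_char_decomposition proj_reg_repr.
(* The pairing of the regular character with chi is computed twice: the regular character is
   supported at 1, and orthogonality counts the occurrences of chi in [L]. *)
have mult chi : irr_proj_char chi -> chi 1%g = (count_mem chi L)%:R.
  move=> irrchi; apply: (mulIf C_neq0).
  have -> : chi 1%g * #|C|%:R = proj_dot (proj_char proj_reg) chi.
    rewrite /proj_dot (bigD1 1%g) //= big1 => [|x /andP[_ /negPf x1]].
      by rewrite proj_reg_char eqxx mul1r invg1 al1g invr1 mul1r addr0 mulrC.
    by rewrite proj_reg_char x1 !mul0r.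
  rewrite /proj_dot; under eq_bigr => x _ do rewrite sumL mulr_suml.
  rewrite exchange_big /= -sum1_count [in RHS]big_mkcond natr_sum mulr_suml.
  rewrite big_seq [RHS]big_seq.
  apply: eq_bigr => psi /irrL irrpsi; rewrite -/(proj_dot psi chi).
  by rewrite irr_proj_dot //= ; case: (psi == chi).
exists (undup L); split=> [|chi|x]; first exact: undup_uniq.
  rewrite mem_undup; split=> [/irrL//|irrchi].
  have [m [s [rs [m_gt0 _] def_chi]]] := irrchi.
  rewrite -has_pred1 has_count lt0n -(natr_neq0 (count_mem chi L)) -mult //.
  by rewrite def_chi proj_char1 // natr_neq0 -lt0n.
rewrite -proj_reg_char sumL -[RHS]big_undup_iterop_count [LHS]big_seq [RHS]big_seq.
apply: eq_bigr => chi; rewrite mem_undup => /irrL irrchi.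
by rewrite mult // mulr_natl.
Qed.

(** * Irreducible twisted characters over an invariant linear character of a normal subgroup *)

Section OverLinearCharacter.

Variables (H : {group gT}) (lam : gT -> k).
Hypotheses (sHC : H \subset C) (nHC : C \subset 'N(H)%g).
Hypothesis lam_neq0 : {in H, forall h, lam h != 0}.
Hypothesis lamM : {in H &, forall h h',
  lam (h * h')%g = (al h h')^-1 * lam h * lam h'}.
Hypothesis lamJ : {in C & H, forall x h,
  lam h * al (h ^ x^-1)%g x = al x h * lam (h ^ x^-1)%g}.

Lemma lam_1 : lam 1%g = 1.
Proof.
apply: (mulIf (lam_neq0 (group1 H))); rewrite mul1r.
by have:= lamM (group1 H) (group1 H); rewrite mulg1 alg1 invr1 mul1r => <-.
Qed.

(** A boolean form of the condition on characters in [S_label], so that it can filter sums over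
    lists. *)
Definition proj_over (chi : {ffun gT -> k}) :=
  [forall h in H, chi h == lam h * chi 1%g].

(* The element |H|^-1 \sum_h (lam h)^-1 h of the twisted group algebra is a
   central idempotent. *)
Definition proj_idem m (s : gT -> 'M[k]_m) : 'M[k]_m :=
  #|H|%:R^-1 *: \sum_(h in H) (lam h)^-1 *: s h.

(** After reindexing the sum by conjugation with y, equality of the coefficients is exactly
    [lamJ]. *)
Lemma proj_idem_comm m (s : gT -> 'M[k]_m) y : proj_repr s -> y \in C ->
  proj_idem s *m s y = s y *m proj_idem s.
Proof.
move=> [_ sM] Cy; rewrite -scalemxAl -scalemxAr; congr (_ *: _).
rewrite mulmx_suml mulmx_sumr (reindex_inj (conjg_inj y^-1%g)) /=.
have nHy : y^-1%g \in 'N(H)%g by rewrite groupV (fintype.subsetP nHC).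
apply: eq_big => [h | h]; rewrite memJ_norm // => Hh.
have Hh' : (h ^ y^-1)%g \in H by rewrite memJ_norm.
have hyE : (h ^ y^-1 * y = y * h)%g by rewrite conjgE invgK -!mulgA mulVg mulg1.
have [Ch Ch'] := (fintype.subsetP sHC _ Hh, fintype.subsetP sHC _ Hh').
rewrite -scalemxAl -scalemxAr !sM // !scalerA hyE.
congr (_ *: _); apply/eqP; rewrite -![(lam _)^-1 * _]mulrC eqr_div ?lam_neq0 //.
by rewrite mulrC lamJ.
Qed.

Lemma proj_idem_eigen m (s : gT -> 'M[k]_m) h : proj_repr s -> h \in H ->
  s h *m proj_idem s = lam h *: proj_idem s.
Proof.
move=> [_ sM] Hh; rewrite -scalemxAr scalerA mulrC -scalerA; congr (_ *: _).
rewrite mulmx_sumr scaler_sumr [RHS](reindex_inj (mulgI h)) /=.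
apply: eq_big => [h' | h' Hh']; first by rewrite groupMl.
have [Ch Ch'] := (fintype.subsetP sHC _ Hh, fintype.subsetP sHC _ Hh').
rewrite -scalemxAr sM // !scalerA lamM //; congr (_ *: _).
by field; rewrite ?al_neq0 ?lam_neq0.
Qed.

Lemma proj_idem_trace m (s : gT -> 'M[k]_m) x : proj_repr s -> x \in C ->
  \tr (proj_idem s *m s x)
  = #|H|%:R^-1 * \sum_(h in H) (lam h)^-1 * al h x * proj_char s (h * x)%g.
Proof.
move=> [_ sM] Cx; rewrite -scalemxAl mxtraceZ; congr (_ * _).
rewrite mulmx_suml raddf_sum; apply: eq_bigr => h Hh /=.
have Ch : h \in C by rewrite (fintype.subsetP sHC).
by rewrite -scalemxAl sM // scalerA mxtraceZ proj_charE ?groupM.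
Qed.

Lemma proj_overP m (s : gT -> 'M[k]_m) : proj_repr s -> proj_irr s ->
  if proj_over (proj_char s) then {in H, forall h, s h = (lam h)%:M}
  else proj_idem s = 0.
Proof.
move=> rs irrs; have m_neq0 : m%:R != 0 :> k by rewrite natr_neq0 -lt0n; case: irrs.
have H_neq0 : #|H|%:R != 0 :> k by rewrite natr_neq0 -lt0n cardG_gt0.
have [|c cE] := irreducible_scalar (f := proj_idem s) irrs.
  by move=> _ [y Cy ->]; rewrite proj_idem_comm.
have [c0 | c_neq0] := eqVneq c 0.
  rewrite c0 raddf0 in cE; rewrite ifN //; apply/negP=> /forall_inP over.
  have := proj_idem_trace rs (group1 C); rewrite cE mul0mx mxtrace0 => /esym/eqP.
  rewrite mulf_eq0 invr_eq0 (negPf H_neq0) (eq_bigr (fun=> m%:R)) => [|h Hh].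
    rewrite sumr_const -mulrnA natr_neq0 muln_eq0 -!natr_neq0.
    by rewrite (negPf H_neq0) (negPf m_neq0).
  rewrite mulg1 alg1 mulr1 (eqP (over h Hh)) mulKf ?lam_neq0 //.
  exact: proj_char1.
have sH h : h \in H -> s h = (lam h)%:M.
  move=> Hh; have := proj_idem_eigen rs Hh.
  rewrite cE mul_mx_scalar scale_scalar_mx mulrC -scale_scalar_mx.
  exact: scalerI.
rewrite ifT //; apply/forall_inP=> h Hh; rewrite proj_char1 //.
by rewrite proj_charE ?(fintype.subsetP sHC) // sH // mxtrace_scalar mulr_natr.
Qed.

(** The right side is the trace of [proj_idem s *m s x], where the idempotent acts as 1 or 0. *)
Lemma proj_over_char m (s : gT -> 'M[k]_m) x :
    proj_repr s -> proj_irr s -> x \in C ->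
  (if proj_over (proj_char s) then proj_char s x else 0)
  = #|H|%:R^-1 * \sum_(h in H) (lam h)^-1 * al h x * proj_char s (h * x)%g.
Proof.
move=> rs irrs Cx; have := proj_overP rs irrs; case: ifP => _ => [sH | e0].
  rewrite (eq_bigr (fun=> proj_char s x)) => [|h Hh].
    by rewrite sumr_const -[X in _ * X]mulr_natl mulKf // natr_neq0 -lt0n cardG_gt0.
  have Ch : h \in C by rewrite (fintype.subsetP sHC).
  rewrite !proj_charE ?groupM // -mulrA -mxtraceZ; have [_ <- //] := rs.
  by rewrite sH // mul_scalar_mx mxtraceZ mulKf ?lam_neq0.
by rewrite -proj_idem_trace // e0 mul0mx mxtrace0.
Qed.

(* The sum is the character of the module induced from lam. *)
Lemma sum_irr_proj_over (L : seq {ffun gT -> k}) x :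
    uniq L -> (forall chi, chi \in L <-> irr_proj_char chi) -> x \in C ->
  \sum_(chi <- L | proj_over chi) chi 1%g * chi x
  = if x \in H then #|C|%:R / #|H|%:R * lam x else 0.
Proof.
move=> uL memL Cx; have [L' [uL' memL' sumL']] := irr_proj_chars.
have eqL : perm_eq L L'.
  apply: uniq_perm => // chi.
  by apply/idP/idP => [/memL/memL' | /memL'/memL].
have overE chi : chi \in L' -> (if proj_over chi then chi 1%g * chi x else 0)
    = #|H|%:R^-1 * \sum_(h in H) (lam h)^-1 * al h x * (chi 1%g * chi (h * x)%g).
  move=> /memL'[m [s [rs irrs ->]]].
  rewrite (eq_bigr _ (fun h _ => mulrCA _ (proj_char s 1%g) _)) -mulr_sumr.
  rewrite mulrCA -proj_over_char //; case: ifP => //; by rewrite mulr0.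
rewrite (perm_big _ eqL) big_mkcond big_seq (eq_bigr _ overE).
rewrite -big_seq -mulr_sumr exchange_big /=.
(* Summing over chi first leaves only the term with hx = 1, which is present only when x lies in
   [H]. *)
under eq_bigr => h _ do rewrite -mulr_sumr sumL' -eq_invg_mul.
case: ifPn => [Hx | nHx].
  rewrite (bigD1 x^-1%g) ?groupV //= big1 => [|h /andP[_ /negPf hx]].
    (* [lamM] at (x^-1, x) gives lam(x^-1) lam(x) = al(x^-1, x), so the surviving coefficient is
       lam(x). *)
    have := lamM (groupVr Hx) Hx; rewrite mulVg lam_1 -mulrA.
    move/(canLR (mulVKf (al_neq0 (groupVr Cx) Cx))); rewrite mulr1 => ->.
    rewrite invgK eqxx mul1r addr0.
    by field; rewrite lam_neq0 ?groupV // natr_neq0 -lt0n cardG_gt0.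
  case: eqP => [e|]; last by rewrite mul0r mulr0.
  by rewrite -e invgK eqxx in hx.
rewrite big1 ?mulr0 // => h Hh; case: eqP => [hx | _]; last by rewrite mul0r mulr0.
by rewrite -hx groupV Hh in nHx.
Qed.

End OverLinearCharacter.

End ProjectiveRepresentations.

(** * Modules over the twisted quantum double *)

Lemma conj_cent1 (gT : finGroupType) (a x : gT) : x \in 'C[a]%g -> (a ^ x)%g = a.
Proof. by move/cent1P=> ax; rewrite conjgE -ax mulKg. Qed.

(** * Identities for [omega] and [beta] *)

Section Cocycle.

Variables (k : closedFieldType) (gT : finGroupType).
Variable omega : gT -> gT -> gT -> k.
Hypothesis omega_cocycle : normalized_3cocycle omega.

Lemma omega_neq0 g h l : omega g h l != 0.
Proof. by case: omega_cocycle. Qed.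

Let omegaM g1 g2 g3 g4 :
  omega g2 g3 g4 * omega g1 (g2 * g3)%g g4 * omega g1 g2 g3
  = omega (g1 * g2)%g g3 g4 * omega g1 g2 (g3 * g4)%g.
Proof. by case: omega_cocycle. Qed.

Let omega_1m g l : omega g 1%g l = 1.
Proof. by case: omega_cocycle. Qed.

(** The cocycle identity at (1, 1, g, l), with the middle normalization, says that this value equals
    its own square. *)
Lemma omega_1l g l : omega 1%g g l = 1.
Proof.
have := omegaM 1%g 1%g g l; rewrite !mul1g !omega_1m !mulr1.
by move/(canRL (mulfK (omega_neq0 _ _ _))); rewrite mulfV ?omega_neq0 // => /esym.
Qed.

Lemma omega_1r g h : omega g h 1%g = 1.
Proof.
have := omegaM g h 1%g 1%g; rewrite !mulg1 !omega_1m !mul1r.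
by move/(canRL (mulfK (omega_neq0 _ _ _))); rewrite mulfV ?omega_neq0 // => /esym.
Qed.

Lemma beta_neq0 a x y : beta omega a x y != 0.
Proof. by rewrite /beta !mulf_neq0 ?invr_eq0 ?omega_neq0. Qed.

Lemma beta1g a x : beta omega a 1%g x = 1.
Proof. by rewrite /beta omega_1m !omega_1l !mul1r invr1. Qed.

Lemma betag1 a x : beta omega a x 1%g = 1.
Proof. by rewrite /beta omega_1m !omega_1r !mul1r invr1. Qed.

Lemma beta_1g x y : beta omega 1%g x y = 1.
Proof. by rewrite /beta !conj1g omega_1m omega_1l omega_1r !mul1r invr1. Qed.

(** This is associativity of the product of D^omega(G). It combines the four cocycle identities in
    which g, suitably conjugated, stands before x, after x, after y and after z. *)
Lemma betaM g x y z :
  beta omega g x y * beta omega g (x * y)%g z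
  = beta omega (g ^ x)%g y z * beta omega g x (y * z)%g.
Proof.
rewrite /beta; set h := (g ^ x)%g; set l := (g ^ (x * y))%g.
have -> : (h ^ (y * z) = g ^ (x * y * z))%g by rewrite -conjgM mulgA.
have -> : (h ^ y = l)%g by rewrite -conjgM.
rewrite (mulgA x y z); set m := (g ^ (x * y * z))%g.
have gx : (g * x = x * h)%g by rewrite conjgC.
have hy : (h * y = y * l)%g by rewrite conjgC -conjgM.
have lz : (l * z = z * m)%g by rewrite conjgC -conjgM.
have e1 := omegaM g x y z; have e2 := omegaM x h y z.
have e3 := omegaM x y l z; have e4 := omegaM x y z m.
rewrite gx in e1; rewrite hy in e2; rewrite lz in e3.
have f1 : omega g (x * y)%g z * omega g x y
   = omega (x * h)%g y z * omega g x (y * z)%g / omega x y z.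
  by rewrite -e1; field; rewrite omega_neq0.
have f2 : (omega x (y * l)%g z)^-1 = omega h y z * omega x h y
   / (omega (x * h)%g y z * omega x h (y * z)%g).
  by rewrite -e2; field; rewrite !omega_neq0.
have f3 : omega x y l / omega (x * y)%g l z
   = omega x y (z * m)%g / (omega y l z * omega x (y * l)%g z).
  apply/eqP; rewrite eqr_div ?mulf_neq0 ?omega_neq0 // mulrC e3 mulrC; exact/eqP.
have f4 : omega (x * y)%g z m * omega x y (z * m)%g
   = omega y z m * omega x (y * z)%g m * omega x y z by rewrite e4.
transitivity ((omega g (x * y)%g z * omega g x y) * (omega x y l / omega (x * y)%g l z)
   * omega (x * y)%g z m / omega x h y); first by field; rewrite !omega_neq0.
rewrite f1 f3 invfM f2.
transitivity ((omega (x * y)%g z m * omega x y (z * m)%g)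
  * (omega (x * h)%g y z * omega g x (y * z)%g / omega x y z)
  * ((omega y l z)^-1 * (omega h y z * omega x h y
   / (omega (x * h)%g y z * omega x h (y * z)%g))) / omega x h y).
  by field; rewrite !omega_neq0.
by rewrite f4; field; rewrite !omega_neq0.
Qed.

(** Conjugation by x fixes a here, so [betaM] becomes the ordinary 2-cocycle identity. *)
Lemma beta_cent1M a : {in 'C[a]%g & &, forall x y z,
  beta omega a x y * beta omega a (x * y)%g z
  = beta omega a y z * beta omega a x (y * z)%g}.
Proof. by move=> x y z Cx _ _; rewrite betaM conj_cent1. Qed.

End Cocycle.

Section DModules.

Local Notation act := Defs.act.

Variables (k : closedFieldType) (gT : finGroupType).
Variable omega : gT -> gT -> gT -> k.
Hypothesis omega_cocycle : normalized_3cocycle omega.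
Implicit Types M N : dmod omega.

Lemma act_mulJ M g x y :
  act M g x *m act M (g ^ x)%g y = beta omega g x y *: act M g (x * y)%g.
Proof. by rewrite act_mul eqxx. Qed.

Lemma act1l M g h x : act M g 1%g *m act M h x = (h == g)%:R *: act M h x.
Proof.
rewrite act_mul conjg1 mul1g; case: eqP => [-> | _]; last by rewrite scale0r.
by rewrite (beta1g omega_cocycle).
Qed.

Lemma act1r M g x h : act M g x *m act M h 1%g = (h == g ^ x)%g%:R *: act M g x.
Proof.
rewrite act_mul mulg1; case: eqP => _; last by rewrite scale0r.
by rewrite (betag1 omega_cocycle).
Qed.

(** The sum [p] of the delta_h over the class of a commutes with the action, so it is a scalar on
    [M]; this scalar is 1 because [p] fixes delta_a M, which is nonzero. *)
Lemma simple_support M a g x :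
  simple M -> act M a 1%g != 0 -> g \notin (a ^: [set: gT])%g -> act M g x = 0.
Proof.
move=> simM Ma0 nag; pose p := \sum_(h in (a ^: [set: gT])%g) act M h 1%g.
have pl h y : p *m act M h y = (h \in a ^: [set: gT])%g%:R *: act M h y.
  rewrite mulmx_suml (eq_bigr _ (fun _ _ => act1l _ _ _ _)) -scaler_suml.
  have [Kh | Kh] := boolP (h \in (a ^: [set: gT])%g).
    rewrite (bigD1 h) //= eqxx big1 ?addr0 // => l /andP[_ /negPf lh].
    by rewrite eq_sym lh.
  by rewrite big1 // => l Kl; case: eqP => // hl; rewrite hl Kl in Kh.
have pr h y : act M h y *m p = (h \in a ^: [set: gT])%g%:R *: act M h y.
  rewrite mulmx_sumr (eq_bigr _ (fun _ _ => act1r _ _ _ _)) -scaler_suml.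
  have -> : (h \in a ^: [set: gT])%g = ((h ^ y)%g \in a ^: [set: gT])%g.
    by rewrite memJ_norm // (fintype.subsetP (class_norm a _)) ?inE.
  have [Kh | Kh] := boolP ((h ^ y)%g \in (a ^: [set: gT])%g).
    rewrite (bigD1 (h ^ y)%g) //= eqxx big1 ?addr0 // => l /andP[_ /negPf lh].
    by rewrite lh.
  by rewrite big1 // => l Kl; case: eqP => // hl; rewrite -hl Kl in Kh.
have [|c cE] := irreducible_scalar (f := p) simM.
  by move=> _ [h [y ->]]; rewrite pl pr.
have c1 : c = 1.
  have := pl a 1%g; rewrite cE class_refl mul_scalar_mx => /eqP.
  by rewrite -subr_eq0 -scalerBl scaler_eq0 (negPf Ma0) orbF subr_eq0 => /eqP.
by have := pl g x; rewrite cE c1 mul1mx (negPf nag) scale0r.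
Qed.

(* The character of a label is the trace of the whole module M, because
   C_G(a) acts through delta_a M. *)
Lemma has_label_char M X : has_label M X ->
  X.2 = [ffun x => if x \in 'C[X.1]%g then \tr (act M X.1 x) else 0].
Proof.
case: X => a chi [_ _ [m [E [s [/= fullE /andP[_ sE] sP ->]]]]].
apply/ffunP=> x; rewrite !ffunE /=; case: ifP => // Cx.
have FE := mulVpmx fullE; move: (pinvmx E) FE => F FE.
(* The columns of [E] span delta_a M, and [F *m E = 1%:M], so [E *m F] is the identity on that
   subspace. *)
have EFa : E *m F *m act M a 1%g = act M a 1%g.
  have /submxP[Z /(canRL (@trmxK _ _ _)) ->] := sE.
  by rewrite trmx_mul trmxK -mulmxA (mulmxA F) FE mul1mx.
have axa : act M a x *m act M a 1%g = act M a x.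
  by rewrite act1r (conj_cent1 Cx) eqxx scale1r.
rewrite -axa -EFa mulmxA mxtrace_mulC !mulmxA act1l eqxx scale1r sP //.
by rewrite mxtrace_mulC mulmxA FE mul1mx.
Qed.

Lemma dhom_iso_char M N (f : 'M_(dmod_dim M, dmod_dim N)) g a x :
  dhom f -> f *m g = 1%:M -> g *m f = 1%:M -> \tr (act M a x) = \tr (act N a x).
Proof.
move=> hf fg gf; rewrite -[act M a x]mulmx1 -fg mulmxA -hf -mulmxA mxtrace_mulC.
by rewrite -mulmxA gf mulmx1.
Qed.

(** As [M] is nonzero there is a summand; its injection is nonzero, having a left inverse, hence an
    isomorphism by Schur's lemma. *)
Lemma simple_summand M r (N : 'I_r -> dmod omega) :
    simple M -> (forall i, simple (N i)) -> is_direct_sum M N ->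
  exists i (f : 'M_(dmod_dim M, dmod_dim (N i))) g,
    [/\ dhom f, f *m g = 1%:M & g *m f = 1%:M].
Proof.
move=> simM simN [inj [prj [hom prj_inj _ sum1]]].
have [i] : exists i : 'I_r, True.
  case: r N simN inj prj hom prj_inj sum1 => [|r] N simN inj prj hom prj_inj sum1;
    last by exists ord0.
  have [M_gt0 _] := simM; move/matrixP: sum1 => /(_ (Ordinal M_gt0) (Ordinal M_gt0)).
  by rewrite big_ord0 !mxE eqxx => /esym/eqP; rewrite oner_eq0.
have [hf _] := hom i; exists i, (inj i).
case: (irreducible_iso (f := inj i) (simN i) simM).
- by move=> _ [g [x ->]]; exists (act M g x); rewrite hf.
- by move=> _ [g [x ->]]; exists (act (N i) g x); rewrite hf.
- have [N_gt0 _] := simN i; move=> f0; have := prj_inj i; rewrite f0 mulmx0.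
  move/matrixP => /(_ (Ordinal N_gt0) (Ordinal N_gt0)).
  by rewrite !mxE eqxx => /esym/eqP; rewrite oner_eq0.
by case=> g [fg gf]; exists g.
Qed.

Lemma is_direct_sum_refl M : is_direct_sum M (fun _ : 'I_1 => M).
Proof.
exists (fun=> 1%:M), (fun=> 1%:M); split.
- by move=> i; split=> g x; rewrite mul1mx mulmx1.
- by move=> i; rewrite mulmx1.
- by move=> i j; rewrite !ord1 eqxx.
by rewrite big_ord1 mulmx1.
Qed.

Lemma is_direct_sum_act M r (N : 'I_r -> dmod omega) : is_direct_sum M N ->
  exists (inj : forall i, 'M_(dmod_dim M, dmod_dim (N i)))
         (prj : forall i, 'M_(dmod_dim (N i), dmod_dim M)),
    \sum_i inj i *m prj i = 1%:M
    /\ forall g x, act M g x = \sum_i inj i *m act (N i) g x *m prj i.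
Proof.
move=> [inj [prj [hom _ _ sum1]]]; exists inj, prj; split=> // g x.
rewrite -[LHS]mulmx1 -sum1 mulmx_sumr; apply: eq_bigr => i _.
by have [-> _] := hom i; rewrite mulmxA.
Qed.

End DModules.

Lemma fin_mx_sum (k : closedFieldType) (T I : finType) (f : I -> T -> T -> k) :
  \sum_i fin_mx (f i) = fin_mx (fun x y => \sum_i f i x y).
Proof.
by apply/matrixP=> i j; rewrite summxE mxE; apply: eq_bigr => l _; rewrite mxE.
Qed.

(** * The simple module with a given label, by induction from the centralizer *)

Section InducedModule.

Local Notation act := Defs.act.

Variables (k : closedFieldType) (gT : finGroupType).
Variable omega : gT -> gT -> gT -> k.
Hypothesis omega_cocycle : normalized_3cocycle omega.
Variables (a : gT) (m : nat) (s : gT -> 'M[k]_m).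
Hypothesis repr_s : beta_repr omega a s.

Local Notation cls := (a ^: [set: gT])%g.

(** A chosen element conjugating g to a. The choice 1 at g = a makes the component of degree a equal
    to the given module on the nose. *)
Definition to_base (g : gT) : gT :=
  if g == a then 1%g else odflt 1%g [pick y | (g ^ y == a)%g].

Lemma to_base1 : to_base a = 1%g.
Proof. by rewrite /to_base eqxx. Qed.

Lemma to_baseP g : g \in cls -> (g ^ to_base g)%g = a.
Proof.
rewrite /to_base; case: eqP => [-> _ | _]; first by rewrite conjg1.
case/imsetP=> x _ ->; case: pickP => [y /eqP //|/(_ x^-1%g)].
by rewrite conjgK eqxx.
Qed.

Lemma mem_clsJ g x : (g ^ x \in cls)%g = (g \in cls).
Proof. by rewrite memJ_norm // (fintype.subsetP (class_norm a _)) ?inE. Qed.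

(** The element c of C_G(a) with [to_base g * c = x * to_base (g ^ x)], by which x acts between the
    identified components. *)
Definition ind_elt (g x : gT) : gT := ((to_base g)^-1 * x * to_base (g ^ x))%g.

Lemma ind_elt_cent g x : g \in cls -> ind_elt g x \in 'C[a]%g.
Proof.
move=> Kg; have ca : (a ^ ind_elt g x)%g = a.
  by rewrite /ind_elt !conjgM -{1}(to_baseP Kg) conjgK to_baseP // mem_clsJ.
by apply/cent1P; rewrite /commute [RHS]conjgC ca.
Qed.

(* The action of x from the component of degree x^-1 g x to that of degree g
   of the induced module, the component of degree g being identified with V
   through delta_g (to_base g). *)
Definition ind_mx (g x : gT) : 'M[k]_m :=
  (beta omega g x (to_base (g ^ x)%g) / beta omega g (to_base g) (ind_elt g x))
    *: s (ind_elt g x).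

Lemma ind_mxM g x y : g \in cls ->
  ind_mx g x *m ind_mx (g ^ x)%g y = beta omega g x y *: ind_mx g (x * y)%g.
Proof.
move=> Kg; have [_ sM] := repr_s; have Kh : (g ^ x)%g \in cls by rewrite mem_clsJ.
have [Cc Cd] := (ind_elt_cent x Kg, ind_elt_cent y Kh).
have cd : ind_elt g (x * y) = (ind_elt g x * ind_elt (g ^ x) y)%g.
  by rewrite /ind_elt !mulgA mulgK -conjgM -!mulgA.
have tc : (to_base g * ind_elt g x = x * to_base (g ^ x))%g.
  by rewrite /ind_elt !mulgA mulgV mul1g.
have td : (to_base (g ^ x) * ind_elt (g ^ x) y = y * to_base (g ^ (x * y)))%g.
  by rewrite /ind_elt !mulgA mulgV mul1g conjgM.
rewrite /ind_mx -scalemxAl -scalemxAr sM // !scalerA -cd; congr (_ *: _).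
have e1 := betaM omega_cocycle g (to_base g) (ind_elt g x) (ind_elt (g ^ x) y).
have e2 := betaM omega_cocycle g x (to_base (g ^ x)) (ind_elt (g ^ x) y).
have e3 := betaM omega_cocycle g x y (to_base (g ^ (x * y))).
rewrite to_baseP // tc -cd in e1; rewrite td in e2; rewrite -conjgM.
(* The values of [beta] are abstracted to variables; the three relations are the instances [e1],
   [e2], [e3] of [betaM]. *)
have scal (b A N P P' Q Q' W X Z : k) : N != 0 -> P' != 0 -> Q' != 0 ->
    P' * W = A * N -> P * W = Q' * Z -> b * X = Q * Z ->
    P / P' * (Q / Q') * A = b * (X / N).
  move=> N0 P0 Q0 eW eZ eX; apply: (mulIf N0); rewrite -[LHS]mulrA -eW.
  rewrite [b * _]mulrA divfK // eX.
  transitivity (P * W * Q / Q'); first by field; rewrite P0 Q0.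
  by rewrite eZ; field.
by apply: scal e1 e2 e3; apply: beta_neq0 omega_cocycle _ _ _.
Qed.

Lemma ind_mx1 g : g \in cls -> ind_mx g 1%g = 1%:M.
Proof.
move=> Kg; have [s1 _] := repr_s; rewrite /ind_mx /ind_elt conjg1 mulg1 mulVg s1.
by rewrite beta1g // betag1 // divr1 scale1r.
Qed.

Lemma ind_mx_base x : x \in 'C[a]%g -> ind_mx a x = s x.
Proof.
move=> Cx; rewrite /ind_mx /ind_elt conj_cent1 // to_base1 invg1 mul1g mulg1.
by rewrite beta1g // betag1 // divr1 scale1r.
Qed.

Definition ind_type := ({g : gT | g \in cls} * 'I_m)%type.

Lemma ind_type_eq g h (Kg : g \in cls) (Kh : h \in cls) (i j : 'I_m) :
  ((exist _ g Kg, i) == (exist _ h Kh, j) :> ind_type) = (g == h) && (i == j).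
Proof.
apply/eqP/andP => [[-> ->] // | [/eqP gh /eqP->]].
by congr (_, _); apply: val_inj.
Qed.

Definition ind_act (g x : gT) : 'M[k]_#|{: ind_type}| :=
  fin_mx (fun u v : ind_type =>
    if (val u.1 == g) && (val v.1 == g ^ x)%g then ind_mx g x u.2 v.2 else 0).

Lemma ind_act_unit : \sum_(g : gT) ind_act g 1%g = 1%:M.
Proof.
rewrite fin_mx_sum -fin_mx1; apply: eq_fin_mx => -[[g Kg] i] [[h Kh] j] /=.
rewrite (bigD1 g) //= big1 => [|l /negPf lg]; last by rewrite eq_sym lg.
rewrite eqxx conjg1 addr0 ind_mx1 // mxE ind_type_eq eq_sym.
by case: (g == h).
Qed.

Lemma ind_act_mul g x h y :
  ind_act g x *m ind_act h y
  = if h == (g ^ x)%g then beta omega g x y *: ind_act g (x * y)%g else 0.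
Proof.
rewrite fin_mxM; case: eqP => [-> | neq]; last first.
  apply/matrixP=> i j; rewrite !mxE; apply: big1 => w _.
  case: ifP => [/andP[_ /eqP wg]|]; last by rewrite mul0r.
  by case: ifP => [/andP[/eqP wh _]|]; [case: neq; rewrite -wh | rewrite mulr0].
rewrite fin_mxZ; apply: eq_fin_mx => -[[u Ku] i] [[v Kv] j] /=.
have [ug | ug] := eqVneq u g; last by rewrite /= mulr0 big1 // => w _; rewrite mul0r.
rewrite /= -conjgM; have [vh | vh] := eqVneq v (g ^ (x * y))%g; last first.
  by rewrite mulr0 big1 // => w _; rewrite andbF mulr0.
have Kg : g \in cls by rewrite -ug.
have Kh : (g ^ x)%g \in cls by rewrite mem_clsJ.
rewrite -(pair_bigA _ (fun w l =>
  (if val w == (g ^ x)%g then ind_mx g x i l else 0)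
  * (if (val w == (g ^ x)%g) && true then ind_mx (g ^ x)%g y l j else 0))) /=.
rewrite (bigD1 (exist (fun h => h \in cls) _ Kh)) //=.
rewrite [X in _ + X]big1 => [|w /eqP neq]; last first.
  case: eqP => [wh | _]; first by case: neq; apply: val_inj.
  by apply: big1 => l _; exact: mul0r.
rewrite eqxx addr0; have /matrixP/(_ i j) := ind_mxM x y Kg.
by rewrite !mxE => <-.
Qed.

Definition ind_dmod : dmod omega := DMod ind_act_unit ind_act_mul.

Definition ind_incl : 'M[k]_(dmod_dim ind_dmod, m) :=
  \matrix_(u, j)
    (enum_val (u : 'I_#|{: ind_type}|) == (exist _ a (class_refl _ a), j))%:R.

Lemma tr_ind_inclK : ind_incl^T *m ind_incl = 1%:M.
Proof.
apply/matrixP=> i j; rewrite !mxE /=.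
rewrite (bigD1 (enum_rank ((exist _ a (class_refl _ a), i) : ind_type))) //= big1.
  rewrite !mxE enum_rankK eqxx mul1r addr0 -pair_eqE /= eqxx //.
move=> u /eqP neq; rewrite !mxE; case: eqP => [eu|_]; last by rewrite mul0r.
by case: neq; rewrite -eu enum_valK.
Qed.

Lemma ind_inclE (u : 'I_#|{: ind_type}|) j :
  ind_incl u j = (enum_val u == (exist _ a (class_refl _ a), j))%:R.
Proof. by rewrite mxE. Qed.

Lemma ind_dmodE g x (u v : 'I_#|{: ind_type}|) : act ind_dmod g x u v
  = if (val (enum_val u).1 == g) && (val (enum_val v).1 == g ^ x)%g
    then ind_mx g x (enum_val u).2 (enum_val v).2 else 0.
Proof. by rewrite mxE. Qed.

Lemma ind_inclKtr : ind_incl *m ind_incl^T = act ind_dmod a 1%g.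
Proof.
apply/matrixP=> u v; rewrite ind_dmodE mxE conjg1 /=.
under eq_bigr => j _ do rewrite !mxE.
case: (enum_val u) (enum_val v) => [[g Kg] i] [[h Kh] j] /=.
rewrite ind_mx1 ?class_refl // mxE.
under eq_bigr => l _ do rewrite !ind_type_eq.
have [_ | _] := eqVneq g a; last by rewrite big1 // => l _; rewrite mul0r.
have [_ | _] := eqVneq h a; last by rewrite big1 // => l _; rewrite mulr0.
rewrite /= (bigD1 i) //= eqxx mul1r big1 => [|l /negPf li].
  by rewrite addr0 eq_sym.
by rewrite eq_sym li mul0r.
Qed.

Lemma ind_act_incl x : x \in 'C[a]%g ->
  act ind_dmod a x *m ind_incl = ind_incl *m s x.
Proof.
move=> Cx; apply/matrixP=> u j; rewrite !mxE /=.
under eq_bigr => v _ do rewrite ind_dmodE ind_inclE.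
under [RHS]eq_bigr => l _ do rewrite ind_inclE.
rewrite (bigD1 (enum_rank ((exist _ a (class_refl _ a), j) : ind_type))) //=.
rewrite enum_rankK eqxx mulr1 big1 => [|v /eqP neq]; last first.
  case: (_ =P (_, j)) => [ev | _]; last by rewrite mulr0.
  by case: neq; rewrite -ev enum_valK.
rewrite addr0 conj_cent1 // eqxx andbT.
case: (enum_val u) => [[g Kg] i] /=; under eq_bigr => l _ do rewrite ind_type_eq.
have [ga | _] := eqVneq g a; last by rewrite big1 // => l _; rewrite mul0r.
rewrite ind_mx_base // (bigD1 i) //= eqxx mul1r big1 ?addr0 // => l /negPf li.
by rewrite eq_sym li mul0r.
Qed.

Lemma ind_dmod_act0 g x : g \notin cls -> act ind_dmod g x = 0.
Proof.
move=> nKg; apply/matrixP=> u v; rewrite ind_dmodE [RHS]mxE.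
case: (enum_val u) => [[h Kh] i] /=; case: eqP => //= hg.
by rewrite -hg Kh in nKg.
Qed.

(** The part of a stable [U] in degree a is a submodule of the given irreducible module, hence zero
    or everything. By [act_base] every other component is reached through degree a, so [U] is zero
    or everything too. *)
Lemma simple_ind_dmod :
  mx_irreducible (fun A => exists2 x, x \in 'C[a]%g & A = s x) -> simple ind_dmod.
Proof.
move=> [m_gt0 irr_s]; split.
  by apply/card_gt0P; exists (exist _ a (class_refl _ a), Ordinal m_gt0).
move=> U stU; have {}stU g x u : u \in U -> act ind_dmod g x *m u \in U.
  by apply: stU; exists g, x.
have inclU (u : 'cV_(dmod_dim ind_dmod)) x :
    act ind_dmod a x *m u = ind_incl *m (ind_incl^T *m (act ind_dmod a x *m u)).
  by rewrite mulmxA ind_inclKtr mulmxA act1l // eqxx scale1r.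
have sum_act (u : 'cV_(dmod_dim ind_dmod)) : u = \sum_g act ind_dmod g 1%g *m u.
  by rewrite -mulmx_suml act_unit mul1mx.
have act_base g (u : 'cV_(dmod_dim ind_dmod)) : g \in cls -> act ind_dmod g 1%g *m u
    = (beta omega g (to_base g) (to_base g)^-1%g)^-1 *:
      (act ind_dmod g (to_base g) *m (act ind_dmod a (to_base g)^-1%g *m u)).
  move=> Kg; rewrite mulmxA -[X in act _ X (to_base g)^-1%g](to_baseP Kg).
  by rewrite act_mulJ mulgV -scalemxAl scalerA mulVf ?scale1r // beta_neq0.
case: (irr_s (linfun (mulmx ind_incl) @^-1: U)%VS) => [_ v [x Cx ->]|W0|WT].
- by rewrite -!memv_preim !mulmx_linfunE mulmxA -ind_act_incl // -mulmxA; apply: stU.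
- left; apply/eqP; rewrite -subv0; apply/subvP=> u Uu; rewrite memv0 (sum_act u).
  apply/eqP; apply: big1 => g _; case: (boolP (g \in cls)) => Kg; last first.
    by rewrite ind_dmod_act0 // mul0mx.
  rewrite act_base // inclU; set v := ind_incl^T *m _.
  have : v \in (linfun (mulmx ind_incl) @^-1: U)%VS.
    by rewrite -memv_preim mulmx_linfunE -inclU; apply: stU.
  by rewrite W0 memv0 => /eqP->; rewrite !mulmx0 scaler0.
right; apply/eqP; rewrite eqEsubv subvf; apply/subvP=> u _.
rewrite (sum_act u); apply: memv_suml => g _.
case: (boolP (g \in cls)) => Kg; last first.
  by rewrite ind_dmod_act0 // mul0mx mem0v.
rewrite act_base // memvZ //; apply: stU; rewrite inclU -mulmx_linfunE memv_preim.
by rewrite WT memvf.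
Qed.

Lemma has_label_ind_dmod :
    mx_irreducible (fun A => exists2 x, x \in 'C[a]%g & A = s x) ->
  has_label ind_dmod (a, trace_char a s).
Proof.
move=> irr_s; split=> /=; first exact: simple_ind_dmod.
  apply/eqP=> act0; have [m_gt0 _] := irr_s.
  have : ind_incl^T *m (ind_incl *m ind_incl^T) *m ind_incl = 0.
    by rewrite ind_inclKtr (act0 : act ind_dmod a 1%g = 0) mulmx0 mul0mx.
  rewrite mulmxA tr_ind_inclK mul1mx tr_ind_inclK.
  move/matrixP/(_ (Ordinal m_gt0) (Ordinal m_gt0)).
  by rewrite !mxE eqxx => /eqP; rewrite oner_eq0.
exists m, ind_incl, s; split=> //.
- by apply/row_fullP; exists ind_incl^T; exact: tr_ind_inclK.
- suff: (ind_incl^T == (ind_incl *m ind_incl^T)^T)%MS by rewrite ind_inclKtr.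
  rewrite trmx_mul trmxK submxMl andbT.
  apply/submxP; exists ind_incl^T.
  by rewrite mulmxA tr_ind_inclK mul1mx.
- by move=> x Cx; rewrite ind_act_incl.
Qed.

End InducedModule.

(** * The Gauss sum *)

(** The choice made by [xget] is unique, since [iota] is injective and a nonnegative root in [algC]
    is unique. *)
Lemma pos_sqrt_sqr (k : closedFieldType) (iota : {rmorphism algC -> k}) (r : algC) :
  0 <= r -> pos_sqrt iota (iota r ^+ 2) = iota r.
Proof.
move=> r_ge0; apply: xget_unique; first by split=> //; exists r.
move=> y [+ [r' r_ge0' yE]]; rewrite yE -!rmorphXn => /fmorph_inj/eqP.
by rewrite eqrXn2 // => /eqP->.
Qed.

Lemma transversal_class (gT : finGroupType) (R : {set gT}) x :
    is_transversal R (classes [set: gT]) [set: gT] ->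
  exists r, R :&: (x ^: [set: gT])%g = [set r].
Proof.
case/and3P=> _ _ /forall_inP trR; apply/cards1P; apply: trR.
by apply: mem_classes; rewrite inE.
Qed.

Lemma sum_transversal_classes (V : zmodType) (gT : finGroupType)
    (R A : {set gT}) (f : gT -> V) :
    is_transversal R (classes [set: gT]) [set: gT] ->
    [set: gT] \subset 'N(A)%g -> (forall x y, x \in A -> f (x ^ y)%g = f x) ->
  \sum_(a in A) f a = \sum_(a in A :&: R) f a *+ #|(a ^: [set: gT])%g|.
Proof.
move=> trR nA fJ.
have AJ x y : (x ^ y \in A)%g = (x \in A).
  by rewrite memJ_norm // (fintype.subsetP nA) ?inE.
(* Each inner sum has one term, the representative of the class of a; exchanging the sums then
   counts each representative once per element of its class. *)
transitivity (\sum_(a in A) \sum_(r in R | r \in (a ^: [set: gT])%g) f r).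
  apply: eq_bigr => a Aa.
  have [r Rr] := transversal_class a trR.
  rewrite (eq_bigl (pred1 r)) ?big_pred1_eq => [|x]; last first.
    by rewrite -finset.in_setI Rr finset.inE.
  have: r \in R :&: (a ^: [set: gT])%g by rewrite Rr set11.
  by rewrite inE => /andP[_ /imsetP[y _ ->]]; rewrite fJ.
rewrite (exchange_big_dep (mem R)) /=; last by move=> a r _ /andP[].
rewrite [RHS](eq_bigl (fun r => (r \in R) && (r \in A))); last first.
  by move=> r; rewrite inE andbC.
rewrite big_mkcondr /=; apply: eq_bigr => r Rr.
rewrite (eq_bigl (fun a => (r \in A) && (a \in (r ^: [set: gT])%g))) => [|a].
  case: ifP => Ar; last by rewrite big_pred0.
  by rewrite /= sumr_const.
rewrite Rr /= class_sym; case: imsetP => [[y _ ->]|]; last by rewrite !andbF.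
by rewrite AJ.
Qed.

Section GaussSum.

Local Notation act := Defs.act.

Variables (k : closedFieldType) (gT : finGroupType).
Variables (omega : gT -> gT -> gT -> k) (R : {set gT}) (K H : {group gT}).
Variable B : gT -> gT -> k.
Hypothesis char0 : [pchar k] =i pred0.
Hypothesis omega_cocycle : normalized_3cocycle omega.
Hypothesis R_repr : is_transversal R (classes [set: gT]) [set: gT].
Hypotheses (K_normal : (K <| [set: gT])%g) (H_normal : (H <| [set: gT])%g).
Hypothesis KH_comm : H \subset 'C(K)%g.
Hypothesis B_bichar : omega_bichar omega K H B.
Hypothesis B_inv : G_invariant omega K H B.

Let natr_neq0 n : (n%:R == 0 :> k) = (n == 0)%N.
Proof. by have /pcharf0P-> := char0. Qed.

Let cardG_neq0 (A : {group gT}) : #|A|%:R != 0 :> k.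
Proof. by rewrite natr_neq0 -lt0n cardG_gt0. Qed.

Local Notation G := [set: gT].
Local Notation S := (@S_cat k gT omega R K H B).

Let memJ (A : {group gT}) x y : (A <| G)%g -> (x ^ y \in A)%g = (x \in A).
Proof. by case/andP=> _ nA; rewrite memJ_norm // (fintype.subsetP nA) ?inE. Qed.

Lemma transversal_classes_eq x y :
  x \in R -> y \in R -> x \in (y ^: G)%g -> x = y.
Proof.
move=> Rx Ry xy; have [r Rr] := transversal_class y R_repr.
have: x \in R :&: (y ^: G)%g by rewrite inE Rx.
have: y \in R :&: (y ^: G)%g by rewrite inE Ry class_refl.
by rewrite Rr !inE => /eqP-> /eqP->.
Qed.

Lemma transversal_classes1 : 1%g \in R.
Proof.
have [r Rr] := transversal_class 1%g R_repr.
have: r \in R :&: (1%g ^: G)%g by rewrite Rr set11.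
by rewrite class1G !inE => /andP[Rr' /eqP <-].
Qed.

Lemma sub_cent1 a : a \in K -> H \subset 'C[a]%g.
Proof.
move=> Ka; apply: (fintype.subset_trans KH_comm).
by rewrite -cent_set1 centS ?finset.sub1set.
Qed.

Lemma cent1_norm a : 'C[a]%g \subset 'N(H)%g.
Proof.
by case/andP: H_normal => _; apply: fintype.subset_trans; apply: finset.subsetT.
Qed.

(** This supplies [lamJ] for B(a, -). For x centralizing a, [betaM] at (h', x, x^-1) reduces the
    factor of [G_invariant] to beta_a(x, h) / beta_a(h', x), where h' = x h x^-1. *)
Lemma B_lamJ a : a \in K -> {in 'C[a]%G & H, forall x h,
  B a h * beta omega a (h ^ x^-1)%g x = beta omega a x h * B a (h ^ x^-1)%g}.
Proof.
move=> Ka x h Cx Hh; have := B_inv x Ka Hh; rewrite conj_cent1 // => ->.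
set h' := (h ^ x^-1)%g; have Hh' : h' \in H by rewrite memJ.
have hx : (x * h = h' * x)%g by rewrite /h' conjgE invgK -!mulgA mulVg mulg1.
have := betaM omega_cocycle a h' x x^-1%g.
rewrite mulgV betag1 // mulr1 conj_cent1 ?(fintype.subsetP (sub_cent1 Ka)) // -hx => <-.
have nz := beta_neq0 omega_cocycle.
by field; rewrite !nz.
Qed.

Lemma B_diagJ a x : a \in K :&: H -> B (a ^ x)%g (a ^ x)%g = B a a.
Proof.
case/setIP=> Ka Ha; rewrite B_inv ?memJ // conjgK -conjgC.
have := betaM omega_cocycle a a x x^-1%g.
rewrite mulgV betag1 // mulr1 (conj_cent1 (cent1id a)).
(* Both sides reduce to [omega a x (a ^ x)]. *)
have -> : beta omega a a x = beta omega a x (a ^ x)%g.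
  have nz := omega_neq0 omega_cocycle.
  have ax : (a ^ (a * x) = a ^ x)%g by rewrite conjgM (conj_cent1 (cent1id a)).
  rewrite /beta -conjgC ax (conj_cent1 (cent1id a)).
  by field; rewrite !nz.
have nz := beta_neq0 omega_cocycle; rewrite conjgC => <-.
by field; rewrite !nz.
Qed.

(** A simple object of S(K,H,B) is isomorphic to one of its labelled summands. Isomorphic modules
    have the same support and traces, and [R] meets each class once, so the labels coincide. *)
Lemma S_label_of_object (M : dmod omega) (X : label k gT) :
  X.1 \in R -> S M -> has_label M X -> S_label R K H B X.
Proof.
move=> RX [r [N [sumN labN]]] lX; have [simM X0 [m [E [s [fE sE sP chiE]]]]] := lX.
have simN i : simple (N i) by have [Y _ []] := labN i.
have [i [f [g [hf fg gf]]]] := simple_summand simM simN sumN.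
have [Y SY lY] := labN i; have [Y0 _] := (SY, lY); have [_ Ny0 _] := lY.
have [/finset.setIP[KY RY] _] := SY.
have actE h x : act M h x = f *m act (N i) h x *m g.
  by rewrite hf -mulmxA fg mulmx1.
have XY : X.1 = Y.1.
  apply: transversal_classes_eq => //; apply/negPn/negP=> nXY.
  have := X0; rewrite actE (simple_support omega_cocycle _ (simN i) Ny0 nXY).
  by rewrite mulmx0 mul0mx eqxx.
suff -> : X = Y by [].
have := has_label_char omega_cocycle lX; have := has_label_char omega_cocycle lY.
have trE x : \tr (act M Y.1 x) = \tr (act (N i) Y.1 x).
  exact: (dhom_iso_char _ _ hf fg gf).
case: X XY {RX lX X0 chiE sP sE} => a chi /= -> chiY ->.
rewrite [Y]surjective_pairing chiY; congr (_, _).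
by apply/ffunP=> x; rewrite !ffunE trE.
Qed.

Lemma S_object (M : dmod omega) (X : label k gT) :
  S_label R K H B X -> has_label M X -> S M.
Proof.
move=> SX lX; exists 1%N, (fun=> M); split; first exact: is_direct_sum_refl.
by move=> i; exists X.
Qed.

Lemma Irr_S (X : label k gT) :
  Irr R S X <-> irr_beta_char omega X.1 X.2 /\ S_label R K H B X.
Proof.
split=> [[RX irrX [M SM lX]] | [irrX SX]].
  by split=> //; apply: S_label_of_object SM lX.
have [/finset.setIP[KX RX] _] := SX; split=> //.
have [m [s [rs irrs chiE]]] := irrX.
have lX : has_label (ind_dmod omega_cocycle rs) X.
  case: X chiE {irrX SX KX RX} rs irrs => a chi /= -> rs irrs.
  by apply: has_label_ind_dmod.
by exists (ind_dmod omega_cocycle rs) => //; apply: S_object lX.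
Qed.

Lemma beta_irr_chars : exists L : gT -> seq {ffun gT -> k}, forall a,
  uniq (L a) /\ forall chi, chi \in L a <-> irr_beta_char omega a chi.
Proof.
suff /choice[L memL] : forall a, exists L : seq {ffun gT -> k},
    uniq L /\ forall chi, chi \in L <-> irr_beta_char omega a chi.
  by exists L.
move=> a.
have [L [uL memL _]] := @irr_proj_chars k gT 'C[a]%G (beta omega a) char0
  (fun x y _ _ => beta_neq0 omega_cocycle a x y) (beta_cent1M omega_cocycle (a := a))
  (beta1g omega_cocycle a).
by exists L.
Qed.

(** The list [s] enumerates [Irr R S] without repetition, which turns the sum over a classical set
    into a finite double sum. *)
Lemma sum_Irr_S (L : gT -> seq {ffun gT -> k}) (F : label k gT -> k) :
    (forall a, uniq (L a) /\ forall chi, chi \in L a <-> irr_beta_char omega a chi) ->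
  \sum_(X \in Irr R S) F X
  = \sum_(a in K :&: R) \sum_(chi <- L a | proj_over H (B a) chi) F (a, chi).
Proof.
move=> memL.
pose s := [seq (a, chi) | a <- enum (K :&: R),
                         chi <- [seq chi <- L a | proj_over H (B a) chi]].
have us : uniq s.
  apply: allpairs_uniq_dep; first exact: enum_uniq.
    by move=> a _; rewrite filter_uniq //; case: (memL a).
  by move=> [a chi] [b psi] _ _ /= [-> ->].
have -> : Irr R S = [set` s]%classic.
  apply/seteqP; split=> [[a chi] /Irr_S[irr_chi [Ka over]] | [a chi]] /=.
    apply/allpairsPdep; exists a, chi; rewrite mem_enum mem_filter; split=> //.
    apply/andP; split; last by have [_ ->] := memL a.
    by apply/forall_inP=> h Hh; apply/eqP/over.
  case/allpairsPdep=> b [psi []]; rewrite mem_enum mem_filter => Kb.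
  case/andP=> /forall_inP over Lpsi [-> ->]; apply/Irr_S.
  split; first by have [_ <-] := memL b.
  by split=> // h Hh; apply/eqP/over.
rewrite -fsbig_seq // big_allpairs_dep big_enum_cond /=.
by apply: eq_big => [a | a _]; rewrite ?andbT // big_filter.
Qed.

Lemma sum_S_chars a (L : seq {ffun gT -> k}) x :
    a \in K -> uniq L /\ (forall chi, chi \in L <-> irr_beta_char omega a chi) ->
    x \in 'C[a]%g ->
  \sum_(chi <- L | proj_over H (B a) chi) chi 1%g * chi x
  = if x \in H then #|'C[a]%g|%:R / #|H|%:R * B a x else 0.
Proof.
move=> Ka [uL memL] Cx; have [B_neq0 B_mul _] := B_bichar.
apply: (@sum_irr_proj_over k gT 'C[a]%G (beta omega a)) => //.
- by move=> y z _ _; apply: beta_neq0.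
- exact: beta_cent1M.
- exact: beta1g.
- exact: betag1.
- exact: sub_cent1.
- exact: cent1_norm.
- by move=> h Hh; apply: B_neq0.
- by move=> h h' Hh Hh'; apply: B_mul.
exact: B_lamJ.
Qed.

Lemma card_classM_cent1 a : #|(a ^: G)%g|%:R * #|'C[a]%g|%:R = #|G|%:R :> k.
Proof. by rewrite -index_cent1 finset.setTI mulrC -natrM Lagrange ?finset.subsetT. Qed.

Lemma gauss_sum_S : gauss_sum R S
  = #|G|%:R / #|H|%:R * \sum_(a in K :&: H :&: R) #|(a ^: G)%g|%:R * B a a.
Proof.
have [L memL] := beta_irr_chars; rewrite /gauss_sum (sum_Irr_S _ memL) mulr_sumr.
rewrite [RHS](eq_bigl (fun a => (a \in K :&: R) && (a \in H))); last first.
  by move=> a; rewrite !finset.in_setI andbAC.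
rewrite big_mkcondr /=; apply: eq_bigr => a /finset.setIP[Ka _].
rewrite (eq_bigr (fun chi : {ffun gT -> k} =>
   #|(a ^: G)%g|%:R ^+ 2 * (chi 1%g * chi a))) => [|chi _]; last first.
  (* The twist divides by chi(1); if this is 0, both sides vanish. *)
  rewrite /twist /cat_dim /deg /=; have [-> | chi1] := eqVneq (chi 1%g) 0.
    by rewrite mulr0 expr0n mulr0 mul0r mulr0.
  by field.
rewrite -mulr_sumr sum_S_chars ?cent1id //; case: ifP => _; last by rewrite mulr0.
rewrite -(card_classM_cent1 a); ring.
Qed.

Lemma global_dim_S : global_dim R S = #|G|%:R / #|H|%:R * #|K|%:R.
Proof.
have [L memL] := beta_irr_chars; rewrite /global_dim (sum_Irr_S _ memL).
have -> : #|K|%:R = \sum_(a in K :&: R) (#|(a ^: G)%g|%:R : k).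
  rewrite -sumr_const.
  by rewrite (sum_transversal_classes (f := fun=> 1 : k) R_repr) //;
    case/andP: K_normal.
rewrite mulr_sumr; apply: eq_bigr => a /finset.setIP[Ka _].
rewrite (eq_bigr (fun chi : {ffun gT -> k} =>
   #|(a ^: G)%g|%:R ^+ 2 * (chi 1%g * chi 1%g))) => [|chi _]; last first.
  by rewrite /cat_dim /deg /=; ring.
have [B_neq0 B_mul _] := B_bichar.
have B1 : B a 1%g = 1.
  apply: (mulIf (B_neq0 _ _ Ka (group1 H))); rewrite mul1r.
  have := B_mul a Ka 1%g 1%g (group1 H) (group1 H).
  by rewrite mulg1 betag1 // invr1 mul1r => <-.
rewrite -mulr_sumr sum_S_chars ?group1 // B1.
by rewrite -(card_classM_cent1 a); ring.
Qed.

(** * Transparent objects and nondegeneracy *)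

Lemma S_act0 (Y : dmod omega) g x : S Y -> g \notin K -> act Y g x = 0.
Proof.
move=> [r [N [sumN labN]]] nKg; have [inj [prj [_ ->]]] := is_direct_sum_act sumN.
apply: big1 => i _; have [[a chi] [/finset.setIP[/= Ka _] _] [simN N0 _]] := labN i.
rewrite (simple_support omega_cocycle _ simN N0) ?mulmx0 ?mul0mx //.
by apply: contra nKg => /imsetP[y _ ->]; rewrite memJ.
Qed.

(** Both braidings are the flip: in one, [X] has degree 1 and only delta_h 1bar acts on [Y]; in the
    other, the degrees of [Y] lie in [K], which acts trivially on [X]. *)
Lemma braiding_transparent (X Y : dmod omega) (T : 'M[k]_(dmod_dim X, dmod_dim Y)) :
    (forall g x, g != 1%g -> act X g x = 0) ->
    {in K, forall x, act X 1%g x = 1%:M} -> S Y ->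
  braiding (braiding T) = T.
Proof.
move=> X0 X1 SY.
have X11 : act X 1%g 1%g = 1%:M by apply: X1.
have -> : braiding T = T^T.
  rewrite /braiding (bigD1 1%g) //= [X in _ + X]big1 => [|g g1]; last first.
    by apply: big1 => h _; rewrite X0 // !mul0mx.
  rewrite addr0 X11 -mulmx_sumr mul1mx -raddf_sum /= act_unit trmx1 mulmx1.
  by [].
rewrite /braiding -[RHS]trmxK; congr trmx.
transitivity (\sum_(g : gT) act Y g 1%g *m T^T).
  apply: eq_bigr => g _; rewrite (bigD1 1%g) //= big1 => [|h h1]; last first.
    by rewrite X0 // trmx0 mulmx0.
  rewrite addr0; have [Kg | nKg] := boolP (g \in K).
    by rewrite X1 // trmx1 mulmx1.
  by rewrite S_act0 // !mul0mx.
by rewrite -mulmx_suml act_unit mul1mx.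
Qed.

Lemma nondegenerate_joing : nondegenerate_subcat S -> (K <*> H)%g = G.
Proof.
move=> nondeg; have [L memL] := beta_irr_chars; have [uL1 memL1] := memL 1%g.
set N := (K <*> H)%G.
have N_normal : (N <| G)%g by apply: normalY.
have B1 h : h \in H -> B 1%g h = 1.
  move=> Hh; have [B_neq0 _ B_mul] := B_bichar.
  apply: (mulIf (B_neq0 _ _ (group1 K) Hh)); rewrite mul1r.
  have := B_mul 1%g 1%g (group1 K) (group1 K) h Hh.
  by rewrite mulg1 betag1 // mul1r => <-.
have C1 x : x \in 'C[1%g : gT]%g by apply/cent1P; rewrite /commute mulg1 mul1g.
have sNC : N \subset 'C[1%g : gT]%G by apply/fintype.subsetP => x _; apply: C1.
have nNC : 'C[1%g : gT]%G \subset 'N(N)%g.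
  by case/andP: N_normal => _; apply: fintype.subset_trans; apply: finset.subsetT.
(* Since beta_1 = 1 and C_G(1) = G, the constant 1 serves as the invariant linear character of [N] =
   KH. *)
have lamM : {in N &, forall h h', 1 = (beta omega 1%g h h')^-1 * 1 * 1 :> k}.
  by move=> h h' _ _; rewrite beta_1g // invr1 !mulr1.
have lamJ : {in 'C[1%g : gT]%G & N, forall x h,
    1 * beta omega 1%g (h ^ x^-1)%g x = beta omega 1%g x h * 1}.
  by move=> x h _ _; rewrite !beta_1g // mulr1.
have lam0 : {in N, forall h : gT, 1 != 0 :> k} by move=> *; exact: oner_neq0.
have const chi x : chi \in L 1%g -> proj_over N (fun=> 1) chi -> chi x = chi 1%g.
  move=> /memL1[m [s [rs irrs ->]]] over.
  have s1 : {in N, forall h, s h = 1%:M}.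
    have := @proj_overP k gT 'C[1%g]%G (beta omega 1%g) char0
      (fun x y _ _ => beta_neq0 omega_cocycle 1%g x y) (betag1 omega_cocycle 1%g)
      N (fun=> 1) sNC nNC lam0 lamM lamJ m s rs irrs.
    by rewrite over.
  pose M := ind_dmod omega_cocycle rs.
  have lM : has_label M (1%g, trace_char 1%g s) :=
    has_label_ind_dmod omega_cocycle rs irrs.
  have [simM M1 _] := lM.
  have SM : S M.
    apply: S_object lM; split=> /= [|h Hh].
      by rewrite finset.inE group1 transversal_classes1.
    have Nh : h \in N by rewrite mem_gen // finset.inE Hh orbT.
    by have /forall_inP/(_ h Nh)/eqP-> := over; rewrite B1.
  have M0 g y : g != 1%g -> act M g y = 0.
    by move=> g1; rewrite (simple_support omega_cocycle _ simM M1) // class1G finset.inE.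
  have M11 : act M 1%g 1%g = 1%:M.
    by rewrite -(act_unit M) (bigD1 1%g) //= big1 ?addr0 // => g; exact: M0.
  have MN : {in K, forall y, act M 1%g y = 1%:M}.
    move=> y Ky; have E1 := ind_inclKtr omega_cocycle rs; rewrite -/M M11 in E1.
    rewrite -[LHS]mulmx1 -E1 mulmxA ind_act_incl // s1 ?mulmx1 //.
    by rewrite mem_gen // finset.inE Ky.
  (* [M] centralizes every object, so it is a sum of unit objects, on which all of G acts
     trivially. *)
  have [r [U [sumU unitU]]] := nondeg _ SM
    (fun Y SY T => braiding_transparent T M0 MN SY).
  have [inj [prj [sum1 actU]]] := is_direct_sum_act sumU.
  have Mx y : act M 1%g y = 1%:M.
    rewrite actU -[RHS]sum1; apply: eq_bigr => i _.
    by have [_ ->] := unitU i; rewrite eqxx mulmx1.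
  have chiE := has_label_char omega_cocycle lM.
  by rewrite [trace_char _ _]chiE !ffunE !C1 !Mx.
have sumE x := sum_irr_proj_over char0
  (fun x y _ _ => beta_neq0 omega_cocycle 1%g x y) (beta_cent1M omega_cocycle (a := 1%g))
  (beta1g omega_cocycle 1%g) (betag1 omega_cocycle 1%g) sNC nNC lam0 lamM lamJ
  uL1 memL1 (C1 x).
apply/eqP; rewrite finset.eqEsubset finset.subsetT /=; apply/fintype.subsetP=> x _.
(* By [const] the sum has the same value at x as at 1, where it is |G|/|N| and so nonzero; outside
   [N] it would be 0. *)
have := sumE x; rewrite big_seq_cond.
rewrite (eq_bigr (fun chi : {ffun gT -> k} => chi 1%g * chi 1%g)); last first.
  by move=> chi /andP[Lchi over]; rewrite (const chi x).
rewrite -big_seq_cond sumE group1; case: ifP => // _ /eqP.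
by rewrite mulr1 mulf_eq0 invr_eq0 !(negPf (cardG_neq0 _)).
Qed.

End GaussSum.

Theorem proposition6p8 (k : closedFieldType) (gT : finGroupType)
    (omega : gT -> gT -> gT -> k) (R : {set gT}) (K H : {group gT})
    (B : gT -> gT -> k)
    (char0 : [pchar k] =i pred0)
    (omega_cocycle : normalized_3cocycle omega)
    (R_repr : is_transversal R (classes [set: gT]) [set: gT])
    (K_normal : (K <| [set: gT])%g) (H_normal : (H <| [set: gT])%g)
    (KH_comm : H \subset 'C(K)%g)
    (B_bichar : omega_bichar omega K H B) (B_inv : G_invariant omega K H B) :
  let S : dmod omega -> Prop := S_cat R K H B in
  gauss_sum R S
    = #|[set: gT]|%:R / #|H|%:R
      * \sum_(a in K :&: H :&: R) #|(a ^: [set: gT])%g|%:R * B a a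
  /\ (nondegenerate_subcat S ->
      gauss_sum R S = #|K|%:R / #|K :&: H|%:R * \sum_(a in K :&: H) B a a
      /\ forall iota : {rmorphism algC -> k},
           central_charge R iota S
           = (pos_sqrt iota #|K :&: H|%:R)^-1 * \sum_(a in K :&: H) B a a).
Proof.
move=> S; have tauE := gauss_sum_S char0 omega_cocycle R_repr H_normal
  KH_comm B_bichar B_inv; rewrite -/S in tauE.
have dimE := global_dim_S char0 omega_cocycle R_repr K_normal H_normal
  KH_comm B_bichar B_inv; rewrite -/S in dimE.
split=> // nondeg.
have KH : (K <*> H)%g = [set: gT] := nondegenerate_joing char0 omega_cocycle R_repr
  K_normal H_normal B_bichar nondeg.
have card_neq0 (A : {group gT}) : #|A|%:R != 0 :> k.
  by have /pcharf0P-> := char0; rewrite -lt0n cardG_gt0.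
have KI_neq0 : #|K :&: H|%:R != 0 :> k := card_neq0 (K :&: H)%G.
(* Here G = KH, and |KH| |K cap H| = |K| |H|. *)
have indexE : #|[set: gT]|%:R / #|H|%:R = #|K|%:R / #|K :&: H|%:R :> k.
  apply/eqP; rewrite eqr_div // -!natrM -KH cent_joinEr //.
  by rewrite mul_cardG mulnC.
have tauE' : gauss_sum R S = #|K|%:R / #|K :&: H|%:R * \sum_(a in K :&: H) B a a.
  rewrite tauE indexE; congr (_ * _).
  rewrite (sum_transversal_classes (f := fun a => B a a) R_repr) => [||a x KHa].
  - by apply: eq_bigr => a _; rewrite mulr_natl.
  - by case/andP: (normalI K_normal H_normal).
  exact: B_diagJ omega_cocycle H_normal B_inv _ _ KHa.
split=> // iota; set n := #|K :&: H|.
have r_ge0 : 0 <= sqrtC n%:R :> algC by rewrite sqrtC_ge0 ler0n.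
have rK : iota (sqrtC n%:R) ^+ 2 = n%:R by rewrite -rmorphXn sqrtCK rmorph_nat.
have r_neq0 : iota (sqrtC n%:R) != 0 by rewrite -sqrf_eq0 rK.
have sqrt_n : pos_sqrt iota n%:R = iota (sqrtC n%:R).
  by rewrite -{1}rK pos_sqrt_sqr.
(* By [indexE] the dimension is |K|^2 / n, the square of the image under [iota] of a nonnegative
   number. *)
have sqrt_dim : pos_sqrt iota (global_dim R S) = #|K|%:R / iota (sqrtC n%:R).
  have <- : iota (#|K|%:R / sqrtC n%:R) = #|K|%:R / iota (sqrtC n%:R).
    by rewrite fmorph_div rmorph_nat.
  rewrite -pos_sqrt_sqr ?divr_ge0 ?ler0n //; congr (pos_sqrt _ _).
  by rewrite dimE indexE fmorph_div rmorph_nat expr_div_n rK expr2 mulrAC.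
rewrite /central_charge tauE' sqrt_dim sqrt_n -rK.
by field; rewrite r_neq0 card_neq0.
Qed.
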